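(* Let $q=1$ or $2$, $r\in\mathbb N$, and let $\mathbf z_n=(z_i)_{i=0}^n$ be a partition of $[-1,1]$. There is a constant $\delta=\delta(r)>0$ (depending only on $r$) such that for each $s\in\mathcal S_{q+r}(\mathbf z_n)\cap\Delta^q$ and any $\tilde{\mathbf z}_m\in\mathcal R_\delta(\mathbf z_n)$, there exists a spline $\tilde s\in\widetilde{\mathcal S}_{q+r}(\tilde{\mathbf z}_m)\cap\Delta^q$ satisfying \[ \|s-\tilde s\|_{L_p(\mathcal I_j)}\le c(p,r)\,\omega_{q+r+1}(s,\mathcal I_j)_p,\qquad 0\le j\le n, \] for all $0<p\le\infty$.
   Context: A partition $\mathbf z_n=(z_i)_{i=0}^n$ of $[-1,1]$ is a sequence $-1=z_0<z_1<\dots<z_n=1$; for the definition of $\mathcal I_j$ set $z_j:=z_0$ for $j<0$ and $z_j:=z_n$ for $j>n$, and $\mathcal I_j:=[(z_{j-1}+z_j)/2,(z_j+z_{j+1})/2]$. $\mathcal S_r(\mathbf z_n)$ is the space of piecewise polynomial functions (ppf) of degree $r$ with knots $\mathbf z_n$: $s\in\mathcal S_r(\mathbf z_n)$ if on each $(z_i,z_{i+1})$, $0\le i\le n-1$, $s$ is an algebraic polynomial of degree $\le r$. $\widetilde{\mathcal S}_r(\mathbf z_n):=\mathcal S_r(\mathbf z_n)\cap C^{r-1}[-1,1]$ (splines of minimal defect). $\delta$-remesh: a partition $\tilde{\mathbf z}_m=(\tilde z_i)_{i=0}^m$ of $[-1,1]$ is a $\delta$-remesh of $\mathbf z_n$ if,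 for each $0\le j\le n-1$, \[ \max\{\tilde z_{i+1}-\tilde z_i : [\tilde z_i,\tilde z_{i+1}]\cap(z_j,z_{j+1})\ne\emptyset\}\le\delta\min_{\nu=j-1,j,j+1}|z_{\nu+1}-z_\nu|, \] where in this definition only $z_{-1}:=-\infty$, $z_{n+1}:=+\infty$. $\mathcal R_\delta(\mathbf z_n)$ is the class of all $\delta$-remeshes of $\mathbf z_n$. $\Delta^q=\Delta^q[-1,1]$ is the set of $q$-monotone functions on $[-1,1]$: all divided differences $[f;t_0,\dots,t_q]$ at $q+1$ distinct points of $[-1,1]$ are nonnegative ($q=1$: nondecreasing; $q=2$: convex). $L_p(J)$, $0<p\le\infty$: $\|f\|_{L_p(J)}=(\int_J|f|^p)^{1/p}$ for $p<\infty$, essential supremum for $p=\infty$. $\Delta_h^k(f,x,J)=\sum_{i=0}^k\binom ki(-1)^{k-i}f(x-kh/2+ih)$ if $x\pm kh/2\in J$, and $0$ otherwise; $\omega_k(f,t,J)_p=\sup_{0<h\le t}\|\Delta_h^k(f,\cdot,J)\|_{L_p(J)}$; $\omega_k(f,J)_p:=\omega_k(f,|J|,J)_p$ with $|J|$ the length of $J$. $c(\dots)$ denotes a positive constant depending only on the parameters in parentheses. *)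

(* Defs.v *)
From HB Require Import structures.
From mathcomp Require Export all_boot all_order all_algebra.
From mathcomp Require Export all_classical all_reals all_analysis.
Set Implicit Arguments.
Unset Strict Implicit.
Unset Printing Implicit Defensive.
Export Order.TTheory GRing.Theory Num.Theory.
Export numFieldNormedType.Exports.

#[export] Set Implicit Arguments.
#[export] Unset Strict Implicit.
#[export] Unset Printing Implicit Defensive.

Local Open Scope classical_set_scope.
Local Open Scope ring_scope.

Section Partitions.
Context {R : realType}.
Implicit Types (z zt : seq R).

(* As in [itv_partition], the initial knot z_0 = -1 is not stored:
   z = [:: z_1; ...; z_n] and n = size z. *)
Definition is_partition z : Prop := itv_partition (-1) 1 z.

(* z_i, extended by z_i := z_n = 1 for i > n. *)
Definition knot z (i : nat) : R := nth 1 (-1 :: z) i.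

(* z_j with z_j := z_0 for j < 0 and z_j := z_n for j > n. *)
Definition cknot z (j : int) : R :=
  if j is Posz i then knot z i else knot z 0.

(* z_j with z_j := -oo for j < 0 and z_j := +oo for j > n. *)
Definition eknot z (j : int) : \bar R :=
  match j with
  | Posz i => if (i <= size z)%N then (knot z i)%:E else +oo%E
  | Negz _ => -oo%E
  end.

(* |z_(nu+1) - z_nu|; equal to +oo for nu = -1 and nu = n. *)
Definition egap z (nu : int) : \bar R :=
  (`|eknot z (nu + 1) - eknot z nu|)%E.

Definition Iset z (j : nat) : set R :=
  `[(cknot z (j%:Z - 1) + cknot z j%:Z) / 2,
    (cknot z j%:Z + cknot z (j%:Z + 1)) / 2]%classic.

Definition is_remesh (delta : R) z zt : Prop :=
  is_partition zt /\
  forall j, (j < size z)%N -> forall i, (i < size zt)%N ->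
    `[knot zt i, knot zt i.+1] `&` `]knot z j, knot z j.+1[ !=set0 ->
    ((knot zt i.+1 - knot zt i)%:E <=
      delta%:E * mine (egap z (j%:Z - 1)) (mine (egap z j%:Z)
                                                (egap z (j%:Z + 1))))%E.

End Partitions.

(* In all the definitions below, a function on [-1, 1] is represented by a
   function f : R -> R of which only the values on [-1, 1] are relevant. *)
Section Functions.
Context {R : realType}.
Implicit Types (f g : R -> R) (z : seq R).

Definition ppf (k : nat) z f : Prop :=
  forall i, (i < size z)%N ->
    exists2 P : {poly R}, (size P <= k.+1)%N &
      {in `]knot z i, knot z i.+1[, forall x, f x = P.[x]}.

(* One-sided at the endpoints when D is a closed interval. *)
Definition is_derivative_within (D : set R) f g : Prop :=
  forall x, D x -> (f y - f x) / (y - x) @[y --> within D x^'] --> g x.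

Fixpoint is_Ck (k : nat) (D : set R) f : Prop :=
  if k is k'.+1 then exists2 g, is_derivative_within D f g & is_Ck k' D g
  else {within D, continuous f}.

(* Meant for k >= 1. *)
Definition spline (k : nat) z f : Prop :=
  ppf k z f /\ is_Ck k.-1 `[-1, 1] f.

Definition divided_difference (q : nat) f (t : 'I_q.+1 -> R) : R :=
  \sum_i f (t i) / \prod_(j | j != i) (t i - t j).

Definition q_monotone (q : nat) f : Prop :=
  forall t : 'I_q.+1 -> R, injective t -> (forall i, t i \in `[-1, 1]) ->
    0 <= divided_difference f t.

(* [\_ J] extends by 0 outside J; p ranges over ]0, +oo]. *)
Definition Lpnorm (p : \bar R) (J : set R) f : \bar R :=
  ('N[@lebesgue_measure R]_p [(EFin \o f) \_ J])%E.

Definition Delta (k : nat) (h : R) f (J : set R) (x : R) : R :=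
  if `[< J (x - k%:R * h / 2) /\ J (x + k%:R * h / 2) >] then
    \sum_(i < k.+1) 'C(k, i)%:R * (-1) ^+ (k - i) *
                    f (x - k%:R * h / 2 + i%:R * h)
  else 0.

Definition modulus (k : nat) f (t : R) (J : set R) (p : \bar R) : \bar R :=
  ereal_sup [set Lpnorm p J (Delta k h f J) | h in [set h | 0 < h <= t]].

Definition modulusJ (k : nat) f (J : set R) (p : \bar R) : \bar R :=
  modulus k f (fine (lebesgue_measure J)) J p.

End Functions.

(* Main.v *)
(** Away from small neighbourhoods of the interior knots [st] coincides with [s].
    Near a knot e, where the polynomial pieces P1 and P2 of [s] meet, let h be the
    smaller of the adjacent gaps divided by 2 (q + r + 1).  The jump D = P2 - P1 is
    measured by its largest coefficient B after rescaling [e - h, e + h] to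
    [-1, 1].  An order q + r + 1 difference of [s] with step h, only the last node
    of which lies to the right of e, equals a value of D, and polynomials are large
    on a whole subinterval, so the modulus of smoothness dominates B h^(1/p) up to
    a constant; it remains to replace [s] on [e - h, e + h] with an error O(B).

    This is done on the q-th derivative, a nonnegative measure, which must become a
    nonnegative spline of degree r with the same moments of order < q.  The case
    q = 1 is reduced to q = 2 by taking a primitive.  First P1^(q) and P2^(q) are
    blended, with no sign constraint, on a very short interval [- eta, eta] (scaled
    to e = 0, h = 1): this creates negative values O(B) and moment errors
    O(eta B).  A bump near 0 restores positivity.  As D^(q) is the difference of
    P1^(q) and P2^(q), one of them is at least of the order of B on a subinterval
    of fixed length, where mass of order B >> eta B can be removed; mass added near
    -1 and 1 then restores both moments.  All the bumps are splines supported by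
    the given knots. *)

Require Import Defs.
From mathcomp Require Import ring lra ess_sup_inf measurable_realfun.
Local Open Scope classical_set_scope.
Local Open Scope ring_scope.

(** * Splines as combinations of truncated powers *)

Section TruncatedPowers.
Context {R : realType}.
Implicit Types (t x a b c : R) (p : {poly R}) (L : seq (R * R)).

(** Moments never appear as integrals. A combination of truncated powers vanishes to the left of its
    knots and is the polynomial [tpoly] to the right of them. The single equation
    [tpoly (k + n.+1) L = P2 - P1] therefore says both that the correction leads from P1 to P2 and
    that the k-th derivative keeps its moments of order < k. The q-th derivative of s may have an
    atom at the knot. Its mass d is nonnegative but not controlled by the size b of D^(q), and only
    mass of order b can be removed nearby. All errors are therefore measured by b, while d enters as
    mass to be added, with the favourable sign. The heights of the two end plateaus are nonnegative
    if the barycentre of the mass to be added lies between theirs. They sit beyond 8/10 in absolute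
    value, mass is removed within 7/10, and the margin 1/10 pays for all errors of order eta b. The
    order of choices matters: the bound of the unconstrained blending does not depend on the width
    of the transition zone; then come eta, the knot density eps, and last delta. *)

Definition tpower (n : nat) (t x : R) : R :=
  if t <= x then (x - t) ^+ n / n`!%:R else 0.

(* A list of pairs (coefficient, knot).  Thanks to the normalization by n!,
   the same list represents a spline together with its derivatives and its
   iterated primitives. *)
Definition tspline (n : nat) L (x : R) : R :=
  \sum_(u <- L) u.1 * tpower n u.2 x.

(** What [tspline n L] becomes to the right of all its knots. Raising [n] for a fixed [L] records
    moments: the mass after one primitive, mass and first moment after two. *)
Definition tpoly (n : nat) L : {poly R} :=
  \sum_(u <- L) (u.1 / n`!%:R) *: ('X - u.2%:P) ^+ n.

Definition tscale c L : seq (R * R) := [seq (c * u.1, u.2) | u <- L].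

Definition knots_in (K : seq R) a b L : Prop :=
  forall u, u \in L -> u.2 \in K /\ a <= u.2 <= b.

Lemma tspline_cat n L1 L2 x :
  tspline n (L1 ++ L2) x = tspline n L1 x + tspline n L2 x.
Proof. by rewrite /tspline big_cat. Qed.

Lemma tpoly_cat n L1 L2 : tpoly n (L1 ++ L2) = tpoly n L1 + tpoly n L2.
Proof. by rewrite /tpoly big_cat. Qed.

Lemma tspline_scale n c L x : tspline n (tscale c L) x = c * tspline n L x.
Proof.
rewrite /tspline /tscale big_map mulr_sumr; apply: eq_bigr => u _ /=.
by rewrite mulrA.
Qed.

Lemma tpoly_scale n c L : tpoly n (tscale c L) = c *: tpoly n L.
Proof.
rewrite /tpoly /tscale big_map scaler_sumr; apply: eq_bigr => u _ /=.
by rewrite scalerA mulrA.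
Qed.

Lemma knots_in_cat K a b L1 L2 :
  knots_in K a b L1 -> knots_in K a b L2 -> knots_in K a b (L1 ++ L2).
Proof. by move=> h1 h2 u; rewrite mem_cat => /orP[/h1|/h2]. Qed.

Lemma knots_in_scale K a b c L : knots_in K a b L -> knots_in K a b (tscale c L).
Proof. by move=> h u /mapP[v vL ->]; exact: (h v vL). Qed.

Lemma knots_in_sub K a b a' b' L : a <= a' -> b' <= b ->
  knots_in K a' b' L -> knots_in K a b L.
Proof.
move=> aa bb h u /h[uK /andP[h1 h2]]; split=> //.
by rewrite (le_trans aa)//= (le_trans h2).
Qed.

Lemma tspline_left n K a b L x : (0 < n)%N -> knots_in K a b L -> x <= a ->
  tspline n L x = 0.
Proof.
move=> n0 h xa; rewrite /tspline big_seq big1 // => u /h[_ /andP[au _]].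
rewrite /tpower; case: ifPn => [ux|_]; last by rewrite mulr0.
have -> : x = u.2 by apply/eqP; rewrite eq_le ux (le_trans xa).
by rewrite subrr expr0n -[n]prednK//= mul0r mulr0.
Qed.

Lemma tspline_right n K a b L x : knots_in K a b L -> b <= x ->
  tspline n L x = (tpoly n L).[x].
Proof.
move=> h bx; rewrite /tspline /tpoly horner_sum big_seq [RHS]big_seq.
apply: eq_bigr => u /h[_ /andP[_ ub]].
rewrite /tpower (le_trans ub bx) hornerZ horner_exp hornerXsubC.
by rewrite mulrAC mulrA.
Qed.

Lemma deriv_tpoly n L : (tpoly n.+1 L)^`() = tpoly n L.
Proof.
rewrite /tpoly raddf_sum; apply: eq_bigr => u _.
rewrite /= derivZ deriv_exp derivXsubC mul1r -[_ ^+ _ *+ _]scaler_nat scalerA.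
congr (_ *: _); rewrite factS natrM invfM [_^-1 * _^-1]mulrC mulrA divfK //.
Qed.

Lemma size_tpoly n L : (size (tpoly n L) <= n.+1)%N.
Proof.
rewrite /tpoly; apply: (leq_trans (size_sum _ _ _)); apply/bigmax_leqP_seq => u _ _.
by rewrite (leq_trans (size_scale_leq _ _))// size_exp_XsubC.
Qed.

Lemma is_derive_tpower n t x : is_derive x 1 (tpower n.+2 t) (tpower n.+1 t x).
Proof.
have [xt|tx|->] := ltgtP x t.
- rewrite {2}/tpower leNgt xt /=.
  apply: (@near_eq_is_derive _ _ _ (cst 0)).
  near=> y; rewrite /tpower leNgt.
  suff -> : y < t by [].
  by near: y; exact: lt_nbhsl.
- rewrite {2}/tpower ltW//.
  pose p : {poly R} := n.+2`!%:R^-1 *: ('X - t%:P) ^+ n.+2.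
  apply: (@near_eq_is_derive _ _ _ (horner p)).
    near=> y; rewrite /tpower ifT; last first.
      by apply: ltW; near: y; exact: lt_nbhsr.
    by rewrite /p hornerZ horner_exp hornerXsubC mulrC.
  suff -> : (x - t) ^+ n.+1 / n.+1`!%:R = p^`().[x] by exact: is_derive_poly.
  rewrite /p derivZ deriv_exp derivXsubC mul1r hornerZ hornerMn horner_exp hornerXsubC /=.
  by rewrite [in RHS]factS natrM invfM -[X in _ = _ * X]mulr_natl [RHS]mulrA [n.+2%:R^-1 * _]mulrC divfK ?pnatr_eq0// mulrC.
(* At the knot the difference quotient is exactly [psi h], a continuous function of [h] that
   vanishes at 0. *)
- pose psi (h : R) : R := ((h + `|h|) / 2) ^+ n.+1 / n.+2`!%:R.
  have psi0 : tpower n.+1 t t = psi 0.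
    by rewrite /tpower lexx subrr /psi normr0 addr0 mul0r !expr0n /= !mul0r.
  have H : (fun h => h^-1 *: ((tpower n.+2 t \o shift t) (h *: 1) - tpower n.+2 t t)) @ 0^' --> tpower n.+1 t t.
    rewrite psi0.
    apply: (@cvg_trans _ (psi @ 0^')).
      apply: near_eq_cvg; near=> h.
      have h0 : h != 0 by near: h; exact: nbhs_dnbhs_neq.
      rewrite /= /psi /tpower lexx subrr expr0n /= mul0r subr0 /= -lerBlDr subrr.
      rewrite /GRing.scale /= mulr1 addrK.
      have [hp|hn] := leP 0 h.
        have -> : (h + `|h|) / 2 = h by rewrite ger0_norm//; lra.
        by rewrite [h ^+ n.+2]exprS -mulrA mulKf.
      by rewrite ltr0_norm// subrr mul0r expr0n /= mul0r mulr0.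
    apply: cvg_within_filter.
    have : {for 0, continuous psi}.
      apply: cvgMl; apply: (@continuous_comp _ _ _ (fun h : R => (h + `|h|) / 2) (fun u => u ^+ n.+1)).
        by apply: cvgMl; apply: cvgD; [exact: cvg_id|exact: cvg_norm].
      exact: exprn_continuous.
    by [].
  apply: DeriveDef; first by apply/cvg_ex; exists (tpower n.+1 t t).
  exact: cvg_lim.
Unshelve. all: by end_near. Qed.

Lemma is_derive_tspline n L x :
  is_derive x 1 (tspline n.+2 L) (tspline n.+1 L x).
Proof.
elim: L => [|u L IHL].
  rewrite [X in is_derive _ _ _ X](_ : _ = 0); last by rewrite /tspline big_nil.
  rewrite [X in is_derive _ _ X](_ : _ = cst 0); first exact: is_derive_cst.
  by apply/funext => y; rewrite /tspline big_nil.
rewrite /tspline [X in is_derive _ _ X](_ : _ =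
    (u.1 *: (tpower n.+2 u.2 : R -> R)) + (tspline n.+2 L : R -> R)); last first.
  by apply/funext => y; rewrite big_cons.
rewrite big_cons; apply: is_deriveD => //.
by apply: is_deriveZ; exact: is_derive_tpower.
Qed.

End TruncatedPowers.

(** * Mean value inequalities, used in place of integration *)

Section MeanValue.
Context {R : realType}.
Implicit Types (F G f g : R -> R) (a b B : R).

Lemma derive_le_sub F G f g a b :
  (forall x : R, is_derive x 1 F (f x)) -> (forall x : R, is_derive x 1 G (g x)) ->
  a <= b -> (forall x, a <= x <= b -> f x <= g x) -> F b - F a <= G b - G a.
Proof.
move=> dF dG ab fg.
have dH (x : R) : is_derive x 1 (G - F : R -> R) (g x - f x) by apply: is_deriveB.
have [|x xab E] := @MVT_segment R (G - F) (fun x => g x - f x) a b ab (fun x _ => dH x).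
  apply: derivable_within_continuous => x _.
  by apply: ex_derive; exact: dH.
suff : 0 <= (g x - f x) * (b - a).
  have -> : (g x - f x) * (b - a) = G b - F b - (G a - F a) by rewrite -E.
  by lra.
by rewrite mulr_ge0// subr_ge0// fg// -in_itv.
Qed.

Lemma derive_ge0_le F f a b :
  (forall x : R, is_derive x 1 F (f x)) -> a <= b ->
  (forall x, a <= x <= b -> 0 <= f x) -> F a <= F b.
Proof.
move=> dF ab f0.
have := @derive_le_sub (cst 0) F (cst 0) f a b _ dF ab f0.
by rewrite subrr subr_ge0; apply => x; exact: is_derive_cst.
Qed.

Lemma derive_le_dist F f a b B :
  (forall x : R, is_derive x 1 F (f x)) -> a <= b ->
  (forall x, a <= x <= b -> `|f x| <= B) -> `|F b - F a| <= B * (b - a).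
Proof.
move=> dF ab fB.
have dB (c x : R) : is_derive x 1 (horner (c *: 'X)) c.
  by have := is_derive_poly (c *: 'X) x; rewrite derivZ derivX hornerZ hornerC mulr1.
have hB c x : (c *: 'X : {poly R}).[x] = c * x by rewrite hornerZ hornerX.
have := @derive_le_sub F _ f _ a b dF (dB B) ab _.
have := @derive_le_sub _ F _ f a b (dB (- B)) dF ab _.
rewrite !hB ler_norml => h1 h2.
apply/andP; split.
  rewrite (le_trans _ (h1 _))//; first by lra.
  by move=> x /fB; rewrite ler_norml => /andP[].
rewrite (le_trans (h2 _))//; last by lra.
by move=> x /fB; rewrite ler_norml => /andP[].
Qed.

End MeanValue.

(** * Steps, plateaus and blending on given knots *)

Section Steps.
Context {R : realType}.
Implicit Types (a b c x eps : R) (p q : {poly R}) (L : seq (R * R)) (K : seq R).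

Lemma eq_poly_deriv p q c : p^`() = q^`() -> p.[c] = q.[c] -> p = q.
Proof.
move=> dpq pqc; apply/eqP; rewrite -subr_eq0; apply/eqP.
have d0 : (p - q)^`() = 0 by rewrite derivB dpq subrr.
have s1 : (size (p - q)%R <= 1)%N.
  apply/leq_sizeP => -[//|i] _.
  have := congr1 (fun r : {poly R} => r`_i) d0.
  by rewrite coef_deriv coef0 => /eqP; rewrite mulrn_eq0 => /eqP.
have E := size1_polyC s1; rewrite E.
have : (p - q).[c] = 0 by rewrite hornerD hornerN pqc subrr.
by rewrite {1}E hornerC => h; rewrite E coefC h.
Qed.

(** Only windows contained in [[a, b]] are tested, so the property passes to subintervals with the
    same [eps]. *)
Definition dense K eps a b : Prop :=
  forall c, a <= c -> c + eps <= b -> exists2 t, t \in K & c <= t <= c + eps.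

Lemma dense_sub K eps eps' a b a' b' : a <= a' -> b' <= b -> eps <= eps' ->
  dense K eps a b -> dense K eps' a' b'.
Proof.
move=> aa bb ee h c ac cb.
have [|| t tK /andP[ct tc]] := h c; [lra|lra|].
by exists t => //; rewrite ct; lra.
Qed.

(** Together with [knots_in], the value 1 of [tpoly] makes the spline pass from 0 left of [a] to 1
    right of [b]; the value 0 in [is_plateau] makes it vanish outside [[a, b]]. *)
Definition is_step K n a b L : Prop :=
  [/\ knots_in K a b L, tpoly n L = 1 & forall x, 0 <= tspline n L x <= 1].

Definition is_plateau K n a a' b' b L : Prop :=
  [/\ knots_in K a b L, tpoly n L = 0, forall x, 0 <= tspline n L x <= 1
    & forall x, a' <= x <= b' -> tspline n L x = 1].

(** A step minus a later step. As [a' < b'], the two transition zones are disjoint, so at each point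
    one of the two terms is constant and the difference stays in [0, 1]. *)
Lemma plateau_of_steps K n a a' b' b L1 L2 : (0 < n)%N ->
  a <= a' -> a' < b' -> b' <= b ->
  is_step K n a a' L1 -> is_step K n b' b L2 ->
  is_plateau K n a a' b' b (L1 ++ tscale (-1) L2).
Proof.
move=> n0 aa' ab' b'b [k1 p1 s1] [k2 p2 s2].
have E x : tspline n (L1 ++ tscale (-1) L2) x = tspline n L1 x - tspline n L2 x.
  by rewrite tspline_cat tspline_scale mulN1r.
have E1 x : a' <= x -> tspline n L1 x = 1.
  by move=> h; rewrite (tspline_right _ k1 h) p1 hornerC.
have E2 x : x <= b' -> tspline n L2 x = 0.
  by move=> h; rewrite (tspline_left n0 k2 h).
split.
- apply: knots_in_cat; first by apply: knots_in_sub k1; lra.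
  by apply: knots_in_scale; apply: knots_in_sub k2; lra.
- by rewrite tpoly_cat tpoly_scale p1 p2 scaleN1r subrr.
- move=> x; rewrite E; have [xb|bx] := leP x b'.
    by rewrite E2// subr0.
  by rewrite E1; have := s2 x; lra.
- by move=> x /andP[ax xb]; rewrite E E1// E2// subr0.
Qed.

Lemma plateau_mass K n a a' b' b L : a <= a' -> a' < b' -> b' <= b ->
  is_plateau K n.+1 a a' b' b L ->
  exists2 m, b' - a' <= m <= b - a & tpoly n.+2 L = m%:P.
Proof.
move=> aa' ab' b'b [k p s s1]; exists (tspline n.+2 L b).
  have dF := is_derive_tspline n L.
  have Fa : tspline n.+2 L a = 0 by rewrite (tspline_left _ k).
  have h1 : 0 <= tspline n.+2 L a'.
    rewrite -Fa; apply: (derive_ge0_le dF) => // x _.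
    by case/andP: (s x).
  have h2 : tspline n.+2 L b' <= tspline n.+2 L b.
    apply: (derive_ge0_le dF) => // x _; by case/andP: (s x).
  have dI (x : R) : is_derive x 1 (horner 'X) 1.
    by have := is_derive_poly 'X x; rewrite derivX hornerC.
  have h3 : b' - a' <= tspline n.+2 L b' - tspline n.+2 L a'.
    have := derive_le_sub dI dF (ltW ab'); rewrite !hornerX; apply => x h.
    by rewrite s1.
  have h4 : tspline n.+2 L b - tspline n.+2 L a <= b - a.
    have := derive_le_sub dF dI; move=> /(_ a b); rewrite !hornerX; apply; first by lra.
    by move=> x _; case/andP: (s x).
  by lra.
apply: (@eq_poly_deriv _ _ b); first by rewrite deriv_tpoly p derivC.
by rewrite hornerC (tspline_right _ k).
Qed.

(** Integration by parts: if F is the primitive of the plateau, the integral of F over [a, b] is m b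
    - nu, with nu the first moment. The bounds on [nu] come from 0 <= F <= m. *)
Lemma plateau_moments K n a a' b' b L : a <= a' -> a' < b' -> b' <= b ->
  is_plateau K n.+1 a a' b' b L ->
  exists m nu, [/\ b' - a' <= m <= b - a, m * a <= nu <= m * b,
    tpoly n.+2 L = m%:P & tpoly n.+3 L = m *: 'X - nu%:P].
Proof.
move=> aa' ab' b'b hL; have [m mab Em] := plateau_mass aa' ab' b'b hL.
case: hL => k p s s1.
exists m, (m * b - tspline n.+3 L b).
have dF := is_derive_tspline n L; have dG := is_derive_tspline n.+1 L.
have Fa : tspline n.+2 L a = 0 by rewrite (tspline_left _ k).
have Fb : tspline n.+2 L b = m by rewrite (tspline_right _ k)// Em hornerC.
have Ga : tspline n.+3 L a = 0 by rewrite (tspline_left _ k).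
have F0 x : a <= x <= b -> 0 <= tspline n.+2 L x.
  move=> /andP[ax xb]; rewrite -Fa; apply: (derive_ge0_le dF) => // y _.
  by case/andP: (s y).
have Fm x : a <= x <= b -> tspline n.+2 L x <= m.
  move=> /andP[ax xb]; rewrite -Fb; apply: (derive_ge0_le dF) => // y _.
  by case/andP: (s y).
have ab : a <= b by lra.
split => //.
  have G0 : 0 <= tspline n.+3 L b by rewrite -Ga; exact: (derive_ge0_le dG).
  have : `|tspline n.+3 L b - tspline n.+3 L a| <= m * (b - a).
    apply: (derive_le_dist dG) => // x xab; rewrite ger0_norm; [exact: Fm|exact: F0].
  by rewrite Ga subr0 ger0_norm//; lra.
apply: (@eq_poly_deriv _ _ b).
  by rewrite deriv_tpoly Em derivB derivZ derivX derivC subr0 alg_polyC.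
by rewrite -(tspline_right _ k)// !hornerE; lra.
Qed.

(* A step of degree n + 1 is the normalized primitive of a plateau of degree n. *)
Lemma step_exists n : exists2 eps : R, 0 < eps & forall K a b, a < b ->
  dense K (eps * (b - a)) a b -> exists L, is_step K n.+1 a b L.
Proof.
elim: n => [|n [eps eps0 IHn]].
  exists (1 / 3); first by lra.
  move=> K a b ab h.
  (* One knot in the first third and one in the last third; the difference of the two ramps, divided
     by the distance of the knots, rises from 0 to 1. *)
  have [||t0 t0K t0ab] := h a; [lra|lra|].
  have [||t1 t1K t1ab] := h (b - 1 / 3 * (b - a)); [lra|lra|].
  have t01 : t0 < t1 by lra.
  have t10 : t1 - t0 != 0 by rewrite subr_eq0 gt_eqF.
  exists [:: ((t1 - t0)^-1, t0); (- (t1 - t0)^-1, t1)]; split.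
  - by move=> u; rewrite !inE => /orP[] /eqP -> /=; split=> //; lra.
  - rewrite /tpoly !big_cons big_nil addr0 (_ : 1`! = 1%N)// !divr1 !expr1 /= scaleNr -scalerBr.
    rewrite (_ : 'X - t0%:P - ('X - t1%:P) = (t1 - t0)%:P) ?polyCB; last by ring.
    by rewrite -polyCB -mul_polyC -polyCM mulVf.
  - move=> x; rewrite /tspline !big_cons big_nil addr0 /tpower (_ : 1`! = 1%N)// !divr1 !expr1 /=.
    have i0 : 0 < (t1 - t0)^-1 by rewrite invr_gt0 subr_gt0.
    have E : (t1 - t0)^-1 * (x - t0) - (t1 - t0)^-1 * (x - t1) = 1 by field.
    have [x0|x0] := leP t0 x; have [x1|x1] := leP t1 x; rewrite ?mulr0 ?mulNr ?addr0 ?oppr0.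
    + by rewrite E; lra.
    + rewrite mulr_ge0 ?subr_ge0 ?(ltW i0)//= mulrC ler_pdivrMr ?subr_gt0//; lra.
    + by lra.
    + by lra.
(* The two steps that make up the plateau live on intervals of a third of the length. *)
exists (eps / 3); first by lra.
move=> K a b ab h; pose d := (b - a) / 3.
have d0 : 0 < d by rewrite /d; lra.
have Ed : eps / 3 * (b - a) = eps * d by rewrite /d; lra.
have [||L1 h1] := IHn K a (a + d); first by lra.
  by apply: dense_sub h; rewrite /d; lra.
have [||L2 h2] := IHn K (b - d) b; first by lra.
  by apply: dense_sub h; rewrite /d; lra.
have ab' : a + d < b - d by rewrite /d; lra.
have hL := plateau_of_steps (ltn0Sn n) (_ : a <= a + d) ab' (_ : b - d <= b) h1 h2.
have {}hL := hL ltac:(lra) ltac:(lra).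
have [||m /andP[m1 m2] Em] := plateau_mass _ ab' _ hL; [lra|lra|].
case: hL; set L := _ ++ _ => k p s s1.
have m0 : 0 < m by lra.
have dF := is_derive_tspline n L.
have Fa x : x <= a -> tspline n.+2 L x = 0 by move=> xa; rewrite (tspline_left _ k).
have Fb x : b <= x -> tspline n.+2 L x = m by move=> xb; rewrite (tspline_right _ k)// Em hornerC.
exists (tscale m^-1 L); split.
- exact: knots_in_scale.
- by rewrite tpoly_scale Em -mul_polyC -polyCM mulVf ?gt_eqF.
- move=> x; rewrite tspline_scale mulrC.
  suff /andP[h3 h4] : 0 <= tspline n.+2 L x <= m.
    by rewrite divr_ge0 ?(ltW m0)//= ler_pdivrMr// mul1r.
  have [xa|ax] := leP x a; first by rewrite Fa//; lra.
  have [bx|xb] := leP b x; first by rewrite Fb//; lra.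
  have mono y z : y <= z -> tspline n.+2 L y <= tspline n.+2 L z.
    by move=> yz; apply: (derive_ge0_le dF) => // u _; case/andP: (s u).
  by have := mono _ _ (ltW ax); have := mono _ _ (ltW xb); rewrite (Fa a)// (Fb b)//; lra.
Qed.

Lemma plateau_exists n : exists2 eps : R, 0 < eps & forall K a a' b' b,
  a < a' -> a' < b' -> b' < b -> dense K (eps * (a' - a)) a a' ->
  dense K (eps * (b - b')) b' b -> exists L, is_plateau K n.+1 a a' b' b L.
Proof.
have [eps eps0 h] := step_exists n; exists eps => // K a a' b' b aa ab bb d1 d2.
have [L1 h1] := h K a a' aa d1; have [L2 h2] := h K b' b bb d2.
by exists (L1 ++ tscale (-1) L2); apply: plateau_of_steps => //; exact: ltW.
Qed.

End Steps.

(** * Combinations of truncated powers that end as a given polynomial *)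

Section Interpolation.
Context {R : realType}.
Implicit Types (a b c x eps B C : R) (p q : {poly R}) (L : seq (R * R)) (K : seq R).

Definition coef_bound p B : Prop := forall i, `|p`_i| <= B.

Lemma coef_bound_ge0 p B : coef_bound p B -> 0 <= B.
Proof. by move=> /(_ 0%N); exact: le_trans. Qed.

Lemma horner_bound m p B x : (size p <= m)%N -> coef_bound p B -> `|x| <= 1 ->
  `|p.[x]| <= m%:R * B.
Proof.
move=> sp pB x1; rewrite (horner_coef_wide _ sp) (le_trans (ler_norm_sum _ _ _))//.
rewrite (le_trans (ler_sum _ (_ : forall i, true -> _ <= B)))//; last first.
  by rewrite sumr_const card_ord mulr_natl.
move=> i _; rewrite normrM normrX -[leRHS]mulr1 ler_pM// exprn_ile1//.
Qed.

Lemma coef_bound_deriv m p B : (size p <= m.+1)%N -> coef_bound p B ->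
  coef_bound p^`() (m%:R * B).
Proof.
move=> sp pB i; have B0 := coef_bound_ge0 pB; rewrite coef_deriv.
have [im|mi] := ltnP i m.
  by rewrite -[_ *+ _]mulr_natl normrM normr_nat ler_pM// ler_nat.
by rewrite nth_default ?mul0rn ?normr0 ?mulr_ge0// (leq_trans sp).
Qed.

Lemma size_deriv_le m p : (size p <= m.+1)%N -> (size p^`() <= m)%N.
Proof.
move=> sp; have [->|p0] := eqVneq p 0; first by rewrite deriv0 size_poly0.
by rewrite -ltnS (leq_trans (lt_size_deriv p0)).
Qed.

(** Induction on the degree: a solution for the derivative of [p] is integrated, and the constant by
    which the result misses [p] is supplied by a multiple of a step. [C] does not depend on the
    width [b - a], so the transition zone can later be shrunk at no cost. *)
Lemma spline_of_poly n : exists eps C, [/\ 0 < eps, 0 < C & forall K a b,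
  -1 <= a -> a < b -> b <= 1 -> dense K (eps * (b - a)) a b ->
  forall p B, (size p <= n.+2)%N -> coef_bound p B ->
  exists L, [/\ knots_in K a b L, tpoly n.+1 L = p &
    forall x, -1 <= x <= 1 -> `|tspline n.+1 L x| <= C * B]].
Proof.
elim: n => [|n [eps [C [eps0 C0 IHn]]]].
  have [eps eps0 hstep] := @step_exists R 0.
  exists (Num.min eps 1), 4; split=> //; first by rewrite lt_min eps0 ltr01.
  move=> K a b a1 ab b1 dK p B sp pB; have B0 := coef_bound_ge0 pB.
  have [||t tK tab] := dK a; first by lra.
    suff : Num.min eps 1 * (b - a) <= 1 * (b - a) by lra.
    by rewrite ler_pM2r ?subr_gt0// ge_min lexx orbT.
  have {}tab : a <= t <= b.
    suff : Num.min eps 1 * (b - a) <= 1 * (b - a) by lra.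
    by rewrite ler_pM2r ?subr_gt0// ge_min lexx orbT.
  have [L [kL pL sL]] : exists L, is_step K 1 a b L.
    apply: hstep => //; apply: dense_sub dK => //.
    by rewrite ler_pM2r ?subr_gt0// ge_min lexx.
  have /andP[pB0 pB1] : (`|p`_0| <= B) && (`|p`_1| <= B) by rewrite !pB.
  exists ((p`_1, t) :: tscale (p`_0 + p`_1 * t) L); split.
  - move=> u; rewrite inE => /orP[/eqP -> //|]; exact: knots_in_scale.
  - rewrite -cat1s tpoly_cat tpoly_scale pL /tpoly big_seq1 /= expr1 divr1.
    apply/polyP => i; rewrite !coefE; case: i => [|[|i]] /=.
    + by rewrite sub0r mulr1; ring.
    + by rewrite subr0 mulr1 mulr0 addr0.
    + by rewrite subr0 !mulr0 addr0 nth_default// (leq_trans sp).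
  - move=> x x1; rewrite -cat1s tspline_cat tspline_scale /tspline big_seq1 /=.
    have h1 : `|tpower 1 t x| <= 2.
      rewrite /tpower; case: ifP => _; last by rewrite normr0.
      by rewrite expr1 divr1 ler_norml; lra.
    have h2 : `|p`_0 + p`_1 * t| <= 2 * B.
      rewrite (le_trans (ler_normD _ _))// normrM.
      have : `|p`_1| * `|t| <= B * 1 by rewrite ler_pM// ler_norml; lra.
      lra.
    rewrite (le_trans (ler_normD _ _))// !normrM.
    have h3 : `|p`_1| * `|tpower 1 t x| <= B * 2 by rewrite ler_pM.
    have h4 : `|p`_0 + p`_1 * t| * `|tspline 1 L x| <= 2 * B * 1.
      by rewrite ler_pM// ger0_norm; case/andP: (sL x).
    rewrite /tspline in h4; lra.
have [eps' eps'0 hstep] := @step_exists R n.+1.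
exists (Num.min eps eps'), (n.+3%:R + 4 * C * n.+2%:R); split.
- by rewrite lt_min eps0.
- by rewrite addr_gt0// !mulr_gt0.
move=> K a b a1 ab b1 dK p B sp pB; have B0 := coef_bound_ge0 pB.
have sp' := size_deriv_le sp.
have [||L [kL pL sL]] := IHn K a b a1 ab b1 _ p^`() (n.+2%:R * B) sp'.
- apply: dense_sub dK => //.
  by rewrite ler_pM2r ?subr_gt0// ge_min lexx.
- exact: coef_bound_deriv.
have [||L' [kL' pL' sL']] := hstep K a b => //.
  apply: dense_sub dK => //.
  by rewrite ler_pM2r ?subr_gt0// ge_min lexx orbT.
have dF := is_derive_tspline n L.
pose kappa := p.[1] - (tpoly n.+2 L).[1].
have F0 : tspline n.+2 L (-1) = 0 by rewrite (tspline_left _ kL).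
have hF x : -1 <= x <= 1 -> `|tspline n.+2 L x| <= 2 * C * n.+2%:R * B.
  move=> /andP[x1 x2]; rewrite -[tspline n.+2 L x]subr0 -F0.
  apply: (le_trans (derive_le_dist (B := C * (n.+2%:R * B)) dF x1 _)).
    by move=> y /andP[y1 y2]; apply: sL; lra.
  have : 0 <= C * (n.+2%:R * B) by rewrite !mulr_ge0// ltW.
  by set X := _ * _; move=> X0; have -> : 2 * C * n.+2%:R * B = X * 2; [rewrite /X; ring|rewrite ler_wpM2l//; lra].
have hk : `|kappa| <= n.+3%:R * B + 2 * C * n.+2%:R * B.
  rewrite (le_trans (ler_normB _ _))// lerD//.
    by apply: horner_bound => //; rewrite normr1.
  by rewrite -(tspline_right _ kL)// hF//; lra.
exists (L ++ tscale kappa L'); split.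
- by apply: knots_in_cat => //; exact: knots_in_scale.
- apply: (@eq_poly_deriv _ _ _ 1).
    by rewrite tpoly_cat tpoly_scale pL' derivD derivZ derivC scaler0 addr0 deriv_tpoly.
  by rewrite tpoly_cat tpoly_scale pL' hornerD hornerZ hornerC mulr1 /kappa; ring.
- move=> x x1; rewrite tspline_cat tspline_scale (le_trans (ler_normD _ _))// normrM.
  have h4 : `|kappa| * `|tspline n.+2 L' x| <= (n.+3%:R * B + 2 * C * n.+2%:R * B) * 1.
    by rewrite ler_pM// ger0_norm; case/andP: (sL' x).
  have := hF x x1; move: h4; rewrite mulr1 => h4 h5.
  rewrite (le_trans (lerD h5 h4))// le_eqVlt; apply/orP; left; apply/eqP; ring.
Qed.

End Interpolation.

(** * Polynomials are large on a subinterval *)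

Section LowerBound.
Context {R : realType}.
Implicit Types (a b c x : R) (p q : {poly R}).

Lemma max_coef p : exists k, coef_bound p `|p`_k|.
Proof.
pose m := size p.
case: (@arg_maxP _ _ _ (ord0 : 'I_m.+1) xpredT (fun k : 'I_m.+1 => `|p`_k|) isT) => k _ hk.
exists k => i; have [im|mi] := ltnP i m.+1; first exact: (hk (Ordinal im)).
by rewrite nth_default ?normr0// ltnW.
Qed.

(** Newton interpolation: with [c] the last node, p = p(c) + (X - c) q. At the other nodes the
    separation bounds q by 2 B / sigma, and the induction hypothesis applies to q. *)
Lemma coef_bound_interp m (sigma : R) : 0 < sigma -> exists2 C, 0 < C &
  forall (x : nat -> R) p B, (size p <= m.+1)%N ->
  (forall i, (i <= m)%N -> `|x i| <= 1) ->
  (forall i j, (i < j <= m)%N -> sigma <= `|x i - x j|) ->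
  (forall i, (i <= m)%N -> `|p.[x i]| <= B) -> coef_bound p (C * B).
Proof.
move=> sg0; elim: m => [|m [C C0 IHm]].
  exists 1 => // x p B sp _ _ /(_ 0%N isT) pB i; rewrite mul1r.
  rewrite (size1_polyC sp) hornerC in pB; rewrite (size1_polyC sp) coefC.
  by case: ifP => _ //; rewrite normr0 (le_trans _ pB).
exists (1 + 4 * C / sigma); first by rewrite addr_gt0// divr_gt0// mulr_gt0.
move=> x p B sp x1 xs pB; set c := x m.+1.
have B0 : 0 <= B by apply: le_trans (pB 0%N isT).
have /factor_theorem[q Eq] : root (p - p.[c]%:P) c.
  by rewrite rootE !hornerE subrr.
have sq : (size q <= m.+1)%N.
  have [->|q0] := eqVneq q 0; first by rewrite size_poly0.
  have Es : size (q * ('X - c%:P)) = (size q).+1.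
    by rewrite size_Mmonic ?monicXsubC// size_XsubC addn2.
  rewrite -ltnS -Es -Eq (leq_trans (size_polyD _ _))// geq_max sp size_polyN.
  by rewrite (leq_trans (size_polyC_leq1 _)).
have qB : coef_bound q (C * (2 * B / sigma)).
  apply: (IHm x) => //.
  - by move=> i im; apply: x1; exact: leqW.
  - by move=> i j /andP[ij jm]; apply: xs; rewrite ij leqW.
  move=> i im; have si : sigma <= `|x i - c| by apply: xs; rewrite ltnS im /=.
  have : (q * ('X - c%:P)).[x i] = p.[x i] - p.[c] by rewrite -Eq !hornerE.
  rewrite hornerM hornerXsubC => /(congr1 Num.norm); rewrite normrM => E.
  have h2 : `|p.[x i] - p.[c]| <= 2 * B.
    rewrite (le_trans (ler_normB _ _))//.
    have := pB i (leqW im); have := pB m.+1 (leqnn _); rewrite -/c; lra.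
  rewrite ler_pdivlMr// (le_trans _ h2)// -E ler_wpM2l//.
have Ep : p = q * 'X - c *: q + p.[c]%:P.
  by rewrite -[LHS](subrK p.[c]%:P) Eq mulrBr [q * c%:P]mulrC mul_polyC.
move=> i; rewrite Ep coefD coefB coefMX coefZ coefC.
have Q0 := coef_bound_ge0 qB.
have h1 : `|if i == 0%N then 0 else q`_i.-1| <= C * (2 * B / sigma).
  by case: ifP => _ //; rewrite normr0.
have h2 : `|c * q`_i| <= 1 * (C * (2 * B / sigma)).
  by rewrite normrM ler_pM//; exact: x1.
have h3 : `|if i == 0%N then p.[c] else 0| <= B.
  by case: ifP => _ //; [exact: pB|rewrite normr0].
rewrite (le_trans (ler_normD _ _))// (_ : _ * B = (C * (2 * B / sigma) + 1 * (C * (2 * B / sigma))) + B); last by ring.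
by rewrite lerD// (le_trans (ler_normB _ _))// lerD.
Qed.

(** One of [m.+1] disjoint windows works. Otherwise each contains a point where p is tiny; these
    points are [l] apart, and interpolation bounds the largest coefficient by half of itself. *)
Lemma large_on_subinterval m a b : -1 <= a -> a < b -> b <= 1 ->
  exists c l : R, [/\ 0 < c, 0 < l & forall p, (size p <= m.+1)%N ->
  exists u, [/\ a <= u, u + l <= b & forall x k, u <= x <= u + l ->
    c * `|p`_k| <= `|p.[x]|]].
Proof.
(* Windows of length [l] alternate with gaps of length [l], and [m.+1] windows fit into [[a, b]]. *)
move=> a1 ab b1; pose l := (b - a) / (2 * m.+1%:R).
have l0 : 0 < l by rewrite divr_gt0 ?mulr_gt0 ?subr_gt0.
have [C C0 hC] := coef_bound_interp m l0.
exists (2 * C)^-1, l; split=> //; first by rewrite invr_gt0 mulr_gt0.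
move=> p sp; pose u i : R := a + 2 * i%:R * l.
have [//|no] := pselect (exists u, [/\ a <= u, u + l <= b & forall x k, u <= x <= u + l ->
    (2 * C)^-1 * `|p`_k| <= `|p.[x]|]).
have [k0 pk0] := max_coef p.
have ul i : (i <= m)%N -> u i + l <= b.
  move=> im; have -> : b = a + (2 * m.+1%:R) * l by rewrite /l mulrC divfK ?mulf_neq0 ?pnatr_eq0//; lra.
  have : (2 * i%:R + 1) * l <= (2 * m.+1%:R) * l.
    rewrite ler_pM2r// -[m.+1%:R]natr1; have : (i%:R : R) <= m%:R by rewrite ler_nat.
    lra.
  by rewrite /u; lra.
have ua i : a <= u i by rewrite /u lerDl; apply: mulr_ge0; [rewrite mulr_ge0|exact: ltW].
have : forall i, exists x, (i <= m)%N -> u i <= x <= u i + l /\ `|p.[x]| < (2 * C)^-1 * `|p`_k0|.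
  move=> i; have [im|mi] := leqP i m; last by exists 0.
  apply: contrapT => hno; apply: no; exists (u i); split=> //; first exact: ul.
  move=> x k xu; rewrite leNgt; apply/negP => h; apply: hno; exists x => _; split=> //.
  by apply: (lt_le_trans h); rewrite ler_wpM2l// invr_ge0 ltW// mulr_gt0.
move=> /choice[x hx]; exfalso.
have pb : coef_bound p (C * ((2 * C)^-1 * `|p`_k0|)).
  apply: (hC x) => //.
  - move=> i im; have [/andP[h1 h2] _] := hx i im; rewrite ler_norml.
    by have := ul i im; have := ua i; lra.
  - move=> i j /andP[ij jm]; have im : (i <= m)%N by exact: leq_trans (ltnW ij) jm.
    have [/andP[h1 h2] _] := hx i im; have [/andP[h3 h4] _] := hx j jm.
    rewrite distrC ler_normr; apply/orP; left.
    have : 2 * (i.+1%:R) * l <= 2 * j%:R * l.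
      by rewrite ler_pM2r// ler_pM2l// ler_nat.
    by rewrite -natr1; move: h1 h2 h3 h4; rewrite /u; lra.
  - by move=> i /hx[_ /ltW].
have := pb k0; rewrite mulrA (_ : C * (2 * C)^-1 = 2^-1); last first.
  by rewrite invfM mulrCA divff ?mulr1// gt_eqF.
(* So the largest coefficient is 0, and the strict inequality in [hx] becomes absurd. *)
move=> h; have k00 : `|p`_k0| = 0 by have := normr_ge0 p`_k0; lra.
by have [_] := hx 0%N isT; rewrite k00 mulr0 normr_lt0.
Qed.

End LowerBound.

(** * Blending with positivity and prescribed moments *)

Section Moments.
Context {R : realType}.
Implicit Types (a b c x eps eta B C : R) (p q : {poly R}) (L : seq (R * R)) (K : seq R).

(** Cramer's rule. The two plateaus have barycentres in [-1, -8/10] and [8/10, 1] and the target has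
    its own in [-8/10, 8/10], so the weights are nonnegative. The numerators are at most 18/10 X1
    times one of the masses, while [det] is at least 16/100 times that mass; hence the factor 12. *)
Lemma moment_solve (mL nL mR nR X1 X2 : R) : 1 / 10 <= mL -> 1 / 10 <= mR ->
  nL <= mL * (- (8 / 10)) -> nL >= mL * -1 -> mR * (8 / 10) <= nR -> nR <= mR * 1 ->
  `|X2| <= 8 / 10 * X1 ->
  exists al be, [/\ 0 <= al <= 12 * X1, 0 <= be <= 12 * X1,
    al * mL + be * mR = X1 & al * nL + be * nR = X2].
Proof.
move=> hL hR hnL hnL' hnR hnR'; rewrite ler_norml => hX.
have X0 : 0 <= X1 by lra.
pose det := mL * nR - mR * nL.
have hm : 0 <= (mL - 1 / 10) * mR by rewrite mulr_ge0//; lra.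
have hm' : 0 <= (mR - 1 / 10) * mL by rewrite mulr_ge0//; lra.
have d1 : 16 / 10 * (mL * mR) <= det.
  have : 0 <= mL * (nR - mR * (8 / 10)) by rewrite mulr_ge0//; lra.
  have : 0 <= mR * (mL * (- (8 / 10)) - nL) by rewrite mulr_ge0//; lra.
  rewrite /det; lra.
have d0 : 0 < det by lra.
have e1 : 0 <= (det - 16 / 100 * mR) * X1 by rewrite mulr_ge0//; lra.
have e2 : 0 <= (det - 16 / 100 * mL) * X1 by rewrite mulr_ge0//; lra.
have g1 : 0 <= X1 * (nR - mR * (8 / 10)) by rewrite mulr_ge0//; lra.
have g2 : 0 <= X1 * (mR - nR) by rewrite mulr_ge0//; lra.
have g3 : 0 <= (8 / 10 * X1 - X2) * mR by rewrite mulr_ge0//; lra.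
have g3' : 0 <= (8 / 10 * X1 + X2) * mR by rewrite mulr_ge0//; lra.
have g4 : 0 <= (8 / 10 * X1 + X2) * mL by rewrite mulr_ge0//; lra.
have g4' : 0 <= (8 / 10 * X1 - X2) * mL by rewrite mulr_ge0//; lra.
have g5 : 0 <= X1 * (mL * (- (8 / 10)) - nL) by rewrite mulr_ge0//; lra.
have g6 : 0 <= X1 * (nL + mL) by rewrite mulr_ge0//; lra.
have g7 : 0 <= X1 * mL by rewrite mulr_ge0//; lra.
have g8 : 0 <= X1 * mR by rewrite mulr_ge0//; lra.
have dn : det != 0 by rewrite gt_eqF.
exists ((X1 * nR - X2 * mR) / det), ((X2 * mL - X1 * nL) / det); split.
- rewrite divr_ge0 ?(ltW d0)//=; last by lra.
  by rewrite ler_pdivrMr//; lra.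
- rewrite divr_ge0 ?(ltW d0)//=; last by lra.
  by rewrite ler_pdivrMr//; lra.
- by rewrite /det in dn *; field.
- by rewrite /det in dn *; field.
Qed.

Lemma plateau_outside K n a a' b' b L x : is_plateau K n.+1 a a' b' b L ->
  (x <= a) || (b <= x) -> tspline n.+1 L x = 0.
Proof.
move=> [k p _ _] /orP[h|h]; first by rewrite (tspline_left _ k).
by rewrite (tspline_right _ k)// p horner0.
Qed.

(** A coefficient of [p2 - p1] is at most the sum of those of [p1] and [p2], so one of the two has
    at least half of it. The window stays 1/10 away from 0, clear of the transition zone, and within
    7/10, short of the plateaus where mass is added. *)
Lemma large_left_or_right m : exists c l : R, [/\ 0 < c, 0 < l, l <= 1 &
  forall p1 p2 k, (size p1 <= m.+1)%N -> (size p2 <= m.+1)%N ->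
  (forall x, -1 <= x <= 0 -> 0 <= p1.[x]) -> (forall x, 0 <= x <= 1 -> 0 <= p2.[x]) ->
  exists u, [/\ - (7 / 10) <= u, u + l <= 7 / 10 &
    (u + l <= - (1 / 10) /\ forall x, u <= x <= u + l -> c * `|(p2 - p1)`_k| <= p1.[x]) \/
    (1 / 10 <= u /\ forall x, u <= x <= u + l -> c * `|(p2 - p1)`_k| <= p2.[x])]].
Proof.
have [|||c1 [l1 [c10 l10 h1]]] := @large_on_subinterval R m (- (7 / 10)) (- (1 / 10)); [lra|lra|lra|].
have [|||c2 [l2 [c20 l20 h2]]] := @large_on_subinterval R m (1 / 10) (7 / 10); [lra|lra|lra|].
pose c := Num.min c1 c2; pose l := Num.min l1 l2.
have [cc1 cc2] : c <= c1 /\ c <= c2 by rewrite /c !ge_min !lexx orbT.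
have [ll1 ll2] : l <= l1 /\ l <= l2 by rewrite /l !ge_min !lexx orbT.
have c0 : 0 < c by rewrite lt_min c10.
have l0 : 0 < l by rewrite lt_min l10.
exists (c / 2), l; split=> //; first by lra.
  (* The zero polynomial serves only to learn that a window of length [l1] fits into an interval of
     length 6/10. *)
  by have [u [u1 u2 _]] := h1 0 ltac:(by rewrite size_poly0); lra.
move=> p1 p2 k s1 s2 p10 p20.
have [hk|hk] := leP `|(p2 - p1)`_k| (2 * `|p1`_k|).
  have [u [u1 u2 hu]] := h1 p1 s1; exists u; split; [lra|lra|left; split; first by lra].
  move=> x xu; have := hu x k ltac:(lra); rewrite [leRHS]ger0_norm; last by apply: p10; lra.
  apply: le_trans.
  have : c * `|p1`_k| <= c1 * `|p1`_k| by rewrite ler_wpM2r.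
  have : c * `|(p2 - p1)`_k| <= c * (2 * `|p1`_k|) by rewrite ler_wpM2l// ltW.
  by lra.
have hk2 : `|(p2 - p1)`_k| <= 2 * `|p2`_k|.
  by have := ler_normB p2`_k p1`_k; rewrite -coefB; lra.
have [u [u1 u2 hu]] := h2 p2 s2; exists u; split; [lra|lra|right; split; first by lra].
move=> x xu; have := hu x k ltac:(lra); rewrite [leRHS]ger0_norm; last by apply: p20; lra.
apply: le_trans.
have : c * `|p2`_k| <= c2 * `|p2`_k| by rewrite ler_wpM2r.
have : c * `|(p2 - p1)`_k| <= c * (2 * `|p2`_k|) by rewrite ler_wpM2l// ltW.
by lra.
Qed.

(* The moments of the error of the unconstrained blending, [k1] (up to the jump
   [p^`().[0]] of the derivative, which is mass to be kept) and [k0], are of the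
   order of the width [eta] of the transition zone. *)
Lemma blending_moments K n eta b C p L : 0 < eta -> eta <= 1 / 20 ->
  (size p^`()^`() <= n.+2)%N -> p.[0] = 0 -> coef_bound p^`()^`() b ->
  knots_in K (- eta) eta L -> tpoly n.+1 L = p^`()^`() -> 0 <= C ->
  (forall x, -1 <= x <= 1 -> `|tspline n.+1 L x| <= C * b) ->
  exists k1 k0, [/\ p = tpoly n.+3 L + k1 *: 'X + k0%:P,
    `|k1 - p^`().[0]| <= 2 * ((C + n.+2%:R) * b) * eta &
    `|k0| <= 7 * ((C + n.+2%:R) * b) * eta].
Proof.
move=> eta0 eta1 sp p00 pb kL pL C0 hL.
have b0 := coef_bound_ge0 pb.
set K0 := (C + n.+2%:R) * b; set d := p^`().[0].
pose N : R := n.+2%:R.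
have N0 : 0 <= N by [].
have Cb : 0 <= C * b by rewrite mulr_ge0.
have Nb : 0 <= N * b by rewrite mulr_ge0.
have EK : K0 = C * b + N * b by rewrite /K0 mulrDl.
have dF := is_derive_tspline n L; have dG := is_derive_tspline n.+1 L.
have F0 : tspline n.+2 L (- eta) = 0 by rewrite (tspline_left _ kL).
have G0 : tspline n.+3 L (- eta) = 0 by rewrite (tspline_left _ kL).
have hF x : - eta <= x <= eta -> `|tspline n.+2 L x| <= 2 * (C * b) * eta.
  move=> /andP[x1 x2]; rewrite -[tspline n.+2 L x]subr0 -F0.
  apply: (le_trans (derive_le_dist (B := C * b) dF x1 _)).
    by move=> y /andP[y1 y2]; apply: hL; lra.
  have : 0 <= C * b * (eta - x) by rewrite mulr_ge0//; lra.
  by lra.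
have hG : `|tspline n.+3 L eta| <= 4 * (C * b) * eta * eta.
  rewrite -[tspline n.+3 L eta]subr0 -G0.
  apply: (le_trans (derive_le_dist dG _ hF)); first by lra.
  by rewrite le_eqVlt; apply/orP; left; apply/eqP; ring.
have hD x : 0 <= x <= eta -> `|p^`().[x] - d| <= N * b * eta.
  move=> /andP[x1 x2]; apply: (le_trans (@derive_le_dist R (horner p^`()) (horner p^`()^`()) 0 x (N * b) _ x1 _)).
  - by move=> y hy; apply: horner_bound => //; rewrite ler_norml; lra.
  - by rewrite ler_wpM2l//; lra.
have hP : `|p.[eta] - d * eta| <= N * b * eta * eta.
  have Eh x : (p - d *: 'X).[x] = p.[x] - d * x by rewrite hornerD hornerN hornerZ hornerX.
  have := @derive_le_dist R (horner (p - d *: 'X)) (horner (p - d *: 'X)^`()) 0 eta (N * b * eta).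
  rewrite !Eh p00 mulr0 !subr0; apply; rewrite ?ltW// => x.
  by rewrite derivB derivZ derivX hornerD hornerN hornerZ hornerC mulr1; exact: hD.
(* [p] and [tpoly n.+3 L] have the same second derivative, so they differ by an affine polynomial;
   its coefficients are read off at [eta], where all knots of [L] have been passed. *)
pose k1 := p^`().[eta] - tspline n.+2 L eta.
pose k0 := p.[eta] - tspline n.+3 L eta - k1 * eta.
have hk1 : `|k1 - d| <= (N * b + 2 * (C * b)) * eta.
  have -> : k1 - d = (p^`().[eta] - d) - tspline n.+2 L eta by rewrite /k1; ring.
  rewrite (le_trans (ler_normB _ _))// mulrDl lerD//.
    by apply: hD; lra.
  by apply: hF; lra.
exists k1, k0; split.
- apply: (@eq_poly_deriv _ _ _ eta); last first.
    by rewrite !hornerD hornerZ hornerX hornerC -(tspline_right _ kL)// /k0; ring.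
  have Ed : (tpoly n.+3 L + k1 *: 'X + k0%:P)^`() = tpoly n.+2 L + k1%:P.
    by rewrite !derivD deriv_tpoly derivZ derivX derivC addr0 alg_polyC.
  rewrite Ed; apply: (@eq_poly_deriv _ _ _ eta).
    by rewrite derivD deriv_tpoly derivC pL addr0.
  by rewrite hornerD hornerC -(tspline_right _ kL)// /k1; ring.
- rewrite EK (le_trans hk1)//.
  have : 0 <= N * b * eta by rewrite mulr_ge0// ltW.
  by lra.
- have -> : k0 = (p.[eta] - d * eta) - tspline n.+3 L eta - (k1 - d) * eta by rewrite /k0; ring.
  have h1 : `|(k1 - d) * eta| <= (N * b + 2 * (C * b)) * eta * eta.
    by rewrite normrM (ger0_norm (ltW eta0)) ler_wpM2r// ltW.
  have h2 := ler_normB (p.[eta] - d * eta - tspline n.+3 L eta) ((k1 - d) * eta).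
  have h3 := ler_normB (p.[eta] - d * eta) (tspline n.+3 L eta).
  rewrite (le_trans h2)//.
  have h5 : 0 <= (C * b * eta) * (1 - eta) by rewrite !mulr_ge0 ?(ltW eta0)//; lra.
  have h6 : 0 <= (N * b * eta) * (1 - eta) by rewrite !mulr_ge0 ?(ltW eta0)//; lra.
  have h7 : 0 <= C * b * eta by rewrite mulr_ge0 ?(ltW eta0).
  have h8 : 0 <= N * b * eta by rewrite mulr_ge0 ?(ltW eta0).
  rewrite EK; lra.
Qed.

End Moments.

Section Correction.
Context {R : realType}.
Implicit Types (a b c d l u w x eps eta B C : R) (p q : {poly R}) (L : seq (R * R)) (K : seq R).

(** [g] is the width of the two transition zones: the knots have to be dense relative to [g], not to
    [b - a]. *)
Lemma plateau_guard n : exists2 e : R, 0 < e & forall K eps a g b, 0 < g ->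
  -1 <= a -> a + g < b - g -> b <= 1 -> eps <= e * g -> dense K eps (-1) 1 ->
  exists L m nu, [/\ is_plateau K n.+1 a (a + g) (b - g) b L,
    b - a - 2 * g <= m <= b - a, m * a <= nu <= m * b,
    tpoly n.+2 L = m%:P & tpoly n.+3 L = m *: 'X - nu%:P].
Proof.
have [e e0 hP] := @plateau_exists R n.
exists e => // K eps a g b g0 a1 ab b1 eg dK.
have [|||||L qL] := hP K a (a + g) (b - g) b; [lra|lra|lra| | |].
- by apply: dense_sub dK; lra.
- by apply: dense_sub dK; lra.
have [||m [nu [hm hn E1 E2]]] := plateau_moments _ ab _ qL; [lra|lra|].
by exists L, m, nu; split=> //; lra.
Qed.

(** The two combinations are the first moment X2 and the mass X1 left to the end plateaus. In 8/10
    X1 - |X2| the removed mass counts for at least w mJ / 10, its barycentre being within 7/10, and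
    [d] counts positively. The other terms cost at most 15.8 K0 eta. So w mJ >= 160 K0 eta suffices,
    and this follows from 512 K0 eta <= w l because mJ >= l / 3. *)
Lemma moment_correction_coefs (eta l u K0 w d k0 k1 m0 n0 mJ nJ : R) :
  0 < eta -> eta <= 1 / 20 -> 0 < l -> l <= 1 ->
  - (7 / 10) <= u -> u + l <= 7 / 10 -> 0 <= K0 -> 0 <= w -> 0 <= d ->
  `|k1 - d| <= 2 * K0 * eta -> `|k0| <= 7 * K0 * eta ->
  32 * (16 * (K0 * eta)) <= w * l ->
  2 * eta <= m0 <= 4 * eta -> m0 * - (2 * eta) <= n0 <= m0 * (2 * eta) ->
  l / 3 <= mJ <= l -> mJ * u <= nJ <= mJ * (u + l) ->
  `|- k0 - K0 * n0 + w * nJ| <= 8 / 10 * (k1 - K0 * m0 + w * mJ) /\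
  k1 - K0 * m0 + w * mJ <= d + w + K0.
Proof.
move=> eta0 eta1 l0 l1 u1 u2 K00 w0 d0 hk1 hk0 bud hm0 hn0 hmJ hnJ.
have K0e : 0 <= K0 * eta by rewrite mulr_ge0// ltW.
have budget : 32 * (5 * (K0 * eta)) <= w * mJ.
  clear hn0 hm0 hnJ hk1 hk0 eta1.
  have h2 : 0 <= w * (mJ - l / 3) by rewrite mulr_ge0//; lra.
  by lra.
have hm0' : K0 * m0 <= 4 * (K0 * eta).
  clear budget bud hn0 hnJ hk1 hk0.
  have : 0 <= K0 * (4 * eta - m0) by rewrite mulr_ge0//; lra.
  by lra.
have hm00 : 0 <= K0 * m0 by rewrite mulr_ge0//; clear - hm0 eta0; lra.
have {hn0}hn0 : `|K0 * n0| <= K0 * m0.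
  have h1 : `|n0| <= m0.
    clear - hm0 hn0 eta0 eta1.
    have h3 : 0 <= m0 * (1 - 2 * eta) by rewrite mulr_ge0//; lra.
    by rewrite ler_norml; lra.
  by rewrite normrM (ger0_norm K00) ler_wpM2l.
have {hnJ}hnJ : `|w * nJ| <= 7 / 10 * (w * mJ).
  have h1 : `|nJ| <= 7 / 10 * mJ.
    clear - hmJ hnJ l0 u1 u2.
    have mJ0 : 0 <= mJ by lra.
    have h3 : 0 <= mJ * (7 / 10 - (u + l)) by rewrite mulr_ge0//; lra.
    have h4 : 0 <= mJ * (u + 7 / 10) by rewrite mulr_ge0//; lra.
    by rewrite ler_norml; lra.
  by rewrite normrM (ger0_norm w0) mulrCA ler_wpM2l.
split.
  clear bud hmJ hm0 l0 l1 u1 u2 eta0 eta1.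
  by move: hk1 hk0 hn0 hnJ; rewrite !ler_norml; lra.
have h1 : 0 <= w * (1 - mJ) by rewrite mulr_ge0//; clear - hmJ l1; lra.
have h2 : 0 <= K0 * (1 / 20 - eta) by rewrite mulr_ge0//; clear - eta1; lra.
clear - hk1 h1 h2 hm00 K00; move: hk1; rewrite ler_norml; lra.
Qed.

(* Plateau of height [K0] around 0, minus a plateau of height [w] on [u, u + l],
   plus two plateaus near -1 and 1 whose nonnegative heights are fixed by the two
   moment equations. *)
Lemma moment_correction n eta (l : R) : 0 < eta -> eta <= 1 / 20 -> 0 < l -> l <= 1 ->
  exists2 eps, 0 < eps & forall K, dense K eps (-1) 1 ->
  forall u (K0 : R) w d k0 k1, - (7 / 10) <= u -> u + l <= 7 / 10 ->
  0 <= K0 -> 0 <= w -> 0 <= d ->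
  `|k1 - d| <= 2 * K0 * eta -> `|k0| <= 7 * K0 * eta ->
  32 * (16 * (K0 * eta)) <= w * l ->
  exists L, [/\ knots_in K (-1) 1 L,
    tpoly n.+1 L = 0 /\ tpoly n.+3 L = k1 *: 'X + k0%:P,
    forall x, (x <= u) || (u + l <= x) -> 0 <= tspline n.+1 L x /\
      (- eta <= x <= eta -> K0 <= tspline n.+1 L x),
    forall x, - w <= tspline n.+1 L x &
    forall x, `|tspline n.+1 L x| <= K0 + w + 24 * (d + w + K0)].
Proof.
move=> eta0 eta1 l0 l1.
have [e e0 hP] := plateau_guard n.
(* One requirement per guard width: [eta] for the central bump, [l / 3] for the window where mass is
   removed, [1 / 20] for the end plateaus. *)
pose eps := Num.min (e * eta) (Num.min (e * (l / 3)) (e * (1 / 20))).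
have [e1 e2 e3] : [/\ eps <= e * eta, eps <= e * (l / 3) & eps <= e * (1 / 20)].
  by rewrite /eps !ge_min !lexx !orbT.
exists eps.
  by rewrite /eps !lt_min; repeat (apply/andP; split); apply: mulr_gt0 => //; lra.
move=> K dK.
have [|||L0 [m0 [n0 [q0 hm0 hn0 _ p0]]]] :=
  hP K eps (- (2 * eta)) eta (2 * eta) eta0 _ _ _ e1 dK; [clear - eta0 eta1; lra..|].
have [||||LL [mL [nL [qL hmL hnL _ pL]]]] :=
  hP K eps (-1) (1 / 20) (- (8 / 10)) _ _ _ _ e3 dK; [clear; lra..|].
have [||||LR [mR [nR [qR hmR hnR _ pR]]]] :=
  hP K eps (8 / 10) (1 / 20) 1 _ _ _ _ e3 dK; [clear; lra..|].
move=> u K0 w d k0 k1 u1 u2 K00 w0 d0 hk1 hk0 bud.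
have [||||LJ [mJ [nJ [qJ hmJ hnJ _ pJ]]]] :=
  hP K eps u (l / 3) (u + l) _ _ _ _ e2 dK; [clear - u1 u2 l0 l1; lra..|].
clear e1 e2 e3 dK hP.
(* A plateau of mass m and first moment nu contributes m X - nu to [tpoly n.+3], so the prescribed
   first moment is [- k0]. *)
have [||||X12 X1B] := @moment_correction_coefs eta l u K0 w d k0 k1 m0 n0 mJ nJ
   eta0 eta1 l0 l1 u1 u2 K00 w0 d0 hk1 hk0 bud.
- by clear - hm0; lra.
- by clear - hn0; lra.
- by clear - hmJ; lra.
- by [].
have [||||||al [be [alb beb E1 E2]]] := moment_solve (mL := mL) (nL := nL) (mR := mR) (nR := nR) _ _ _ _ _ _ X12;
 [clear - hmL hnL hmR hnR; lra..|].
pose L := tscale K0 L0 ++ (tscale (- w) LJ ++ (tscale al LL ++ tscale be LR)).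
have EL m x : tspline m L x = K0 * tspline m L0 x +
   (- w * tspline m LJ x + (al * tspline m LL x + be * tspline m LR x)).
  by rewrite /L !tspline_cat !tspline_scale.
have r0 x : 0 <= tspline n.+1 L0 x <= 1 by case: q0.
have rJ x : 0 <= tspline n.+1 LJ x <= 1 by case: qJ.
have rL x : 0 <= tspline n.+1 LL x <= 1 by case: qL.
have rR x : 0 <= tspline n.+1 LR x <= 1 by case: qR.
have hK x : 0 <= K0 * tspline n.+1 L0 x <= K0.
  by have /andP[h h'] := r0 x; rewrite mulr_ge0//= ler_piMr.
have hw x : 0 <= w * tspline n.+1 LJ x <= w.
  by have /andP[h h'] := rJ x; rewrite mulr_ge0//= ler_piMr.
have hal x : 0 <= al * tspline n.+1 LL x <= al.
  by have /andP[h h'] := rL x; case/andP: alb => a1 a2; rewrite mulr_ge0//= ler_piMr.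
have hbe x : 0 <= be * tspline n.+1 LR x <= be.
  by have /andP[h h'] := rR x; case/andP: beb => a1 a2; rewrite mulr_ge0//= ler_piMr.
exists L; split.
- case: q0 qJ qL qR => [k1' _ _ _] [k2' _ _ _] [k3' _ _ _] [k4' _ _ _].
  rewrite /L; do ![apply: knots_in_cat]; apply: knots_in_scale.
  + by apply: knots_in_sub k1'; clear - eta0 eta1; lra.
  + by apply: knots_in_sub k2'; clear - u1 u2 l0; lra.
  + by apply: knots_in_sub k3'; clear; lra.
  + by apply: knots_in_sub k4'; clear; lra.
- rewrite /L !tpoly_cat !tpoly_scale pL pR pJ p0; split.
    case: q0 qJ qL qR => [_ -> _ _] [_ -> _ _] [_ -> _ _] [_ -> _ _].
    by rewrite !scaler0 !addr0.
  apply/polyP => i; rewrite !coefE; case: i => [|[|i]] /=; rewrite ?mulr0 ?sub0r ?subr0 ?addr0 ?mulr1 ?oppr0 ?mulr0 ?addr0//.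
    by rewrite !mulrN; clear - E2; lra.
  by clear - E1; lra.
- move=> x xu; rewrite EL (plateau_outside qJ)// mulr0 add0r; split.
    by clear - hK hal hbe; have := hK x; have := hal x; have := hbe x; lra.
  move=> xe; case: q0 => _ _ _ ->; last by clear - xe; lra.
  by clear - hal hbe; have := hal x; have := hbe x; lra.
- move=> x; rewrite EL.
  by clear - hK hal hbe hw; have := hK x; have := hal x; have := hbe x; have := hw x; lra.
- move=> x; rewrite EL ler_norml.
  by clear - hK hal hbe hw alb beb X1B; have := hK x; have := hal x; have := hbe x; have := hw x; lra.
Qed.

End Correction.

Section PositiveBlending.
Context {R : realType}.
Implicit Types (a b c d l u w x eps eta B C : R) (p q : {poly R}) (L : seq (R * R)) (K : seq R).

(** [p1] and [p2] stand for the second derivatives of the two pieces and [p] for their jump, so the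
    derivative of [p] at 0 is the mass of an atom. The errors are proportional to [b], the largest
    coefficient of the second derivative of [p]; the atom, bounded only in terms of [B], requires no
    removal of mass. *)
Lemma positive_blending n : exists eps C, [/\ 0 < eps, 0 < C & forall K,
  dense K eps (-1) 1 -> forall p1 p2 p B, (size p1 <= n.+2)%N ->
  (size p2 <= n.+2)%N -> (size p <= n.+4)%N -> p^`()^`() = p2 - p1 ->
  p.[0] = 0 -> 0 <= p^`().[0] ->
  (forall x, -1 <= x <= 0 -> 0 <= p1.[x]) ->
  (forall x, 0 <= x <= 1 -> 0 <= p2.[x]) -> coef_bound p B ->
  exists L, [/\ knots_in K (-1) 1 L, tpoly n.+3 L = p,
    forall x, -1 <= x <= 1 -> 0 <= p1.[x] + tspline n.+1 L x &
    forall x, -1 <= x <= 1 -> `|tspline n.+1 L x| <= C * B]].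
Proof.
have [epsU [CU [epsU0 CU0 hU]]] := @spline_of_poly R n.
have [c [l [c0 l0 l1 hJ]]] := @large_left_or_right R n.+1.
pose N : R := n.+2%:R; have N0 : 0 <= N by [].
have CN0 : 0 < CU + N by lra.
(* Chosen so that 512 K0 eta <= w l for K0 = (CU + N) b and w = c b; the factor b cancels. *)
pose eta := Num.min (1 / 20) (c * l / (32 * (16 * (CU + N)))).
have eta0 : 0 < eta.
  rewrite lt_min; apply/andP; split; first by lra.
  by apply: divr_gt0; [exact: mulr_gt0|lra].
have eta1 : eta <= 1 / 20 by rewrite ge_min lexx.
have eta2 : 32 * (16 * ((CU + N) * eta)) <= c * l.
  have h : eta <= c * l / (32 * (16 * (CU + N))) by rewrite ge_min lexx orbT.
  by move: h; rewrite ler_pdivlMr; [lra|lra].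
have [e e0 hcorr] := @moment_correction R n eta l eta0 eta1 l0 l1.
pose eps := Num.min (epsU * (2 * eta)) e.
have [e1 e2] : eps <= epsU * (2 * eta) /\ eps <= e.
  by rewrite /eps !ge_min !lexx !orbT.
pose M : R := n.+2%:R * n.+3%:R; have M0 : 0 <= M by rewrite mulr_ge0.
(* A generous bound for CU b + K0 + w + 24 (d + w + K0), using b <= M B and d <= B. *)
pose C := 50 * (CU + (CU + N) + c) * M + 24.
exists eps, C; split.
- by rewrite /eps lt_min e0 andbT; apply: mulr_gt0 => //; lra.
- by rewrite ltr_wpDl// mulr_ge0//; lra.
move=> K dK p1 p2 p B s1 s2 sp Ep p00 dp0 p10 p20 pB.
have B0 := coef_bound_ge0 pB.
set d := p^`().[0] in dp0.
have dB : d <= B.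
  rewrite /d horner_coef0 coef_deriv; exact: le_trans (ler_norm _) (pB 1%N).
have sp' := size_deriv_le sp; have sp'' := size_deriv_le sp'.
have ppB : coef_bound p^`()^`() (n.+2%:R * (n.+3%:R * B)).
  by apply: coef_bound_deriv => //; apply: coef_bound_deriv.
have [k hk] := max_coef p^`()^`().
set b := `| _ | in hk; have b0 : 0 <= b by exact: normr_ge0.
have bB : b <= M * B by rewrite -mulrA; exact: ppB.
have [u [u1 u2 hu]] := hJ p1 p2 k s1 s2 p10 p20.
rewrite -Ep -/b in hu.
have [||||LU [kU pU sU]] := hU K (- eta) eta _ _ _ _ p^`()^`() b sp'' hk.
- by clear - eta0 eta1; lra.
- by clear - eta0; lra.
- by clear - eta0 eta1; lra.
- by apply: dense_sub dK; clear - eta0 eta1 e1; lra.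
have [k1 [k0 [Ek hk1 hk0]]] := blending_moments eta0 eta1 sp'' p00 hk kU pU (ltW CU0) sU.
rewrite -/d -/N in hk1 hk0.
(* In the transition zone the unconstrained blending is at least -CU b. There [p1] is nonnegative
   left of 0 and, differing from [p2] by the second derivative of [p], at least -N b right of 0. The
   height [K0] makes up for both. *)
set K0 := (CU + N) * b in hk1 hk0; pose w := c * b.
have K00 : 0 <= K0 by rewrite mulr_ge0// ltW.
have w0 : 0 <= w by rewrite mulr_ge0// ltW.
have bud : 32 * (16 * (K0 * eta)) <= w * l.
  have : 0 <= b * (c * l - 32 * (16 * ((CU + N) * eta))).
    by rewrite mulr_ge0// subr_ge0.
  by clear; rewrite /K0 /w; lra.
have [|LC [kC [pC0 pC] sC1 sC2 sC3]] := hcorr K _ u K0 w d k0 k1 u1 u2 K00 w0 dp0 hk1 hk0 bud.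
  by apply: dense_sub dK.
clear hcorr hJ hU dK.
have E x : tspline n.+1 (LU ++ LC) x = tspline n.+1 LU x + tspline n.+1 LC x.
  by rewrite tspline_cat.
have EK : K0 = CU * b + N * b by rewrite /K0 mulrDl.
have CUb : 0 <= CU * b by rewrite mulr_ge0// ltW.
have Nb : 0 <= N * b by rewrite mulr_ge0.
have E12 x : p^`()^`().[x] = p2.[x] - p1.[x] by rewrite Ep hornerD hornerN.
exists (LU ++ LC); split.
- apply: knots_in_cat => //; apply: knots_in_sub kU; clear - eta1; lra.
- by rewrite tpoly_cat pC addrA -Ek.
- move=> x /andP[x1 x2]; rewrite E.
  have Jw : u <= x <= u + l -> x <= 0 /\ w <= p1.[x] \/ 0 <= x /\ w <= p2.[x].
    move=> xu; case: hu => -[hu1 hu2]; [left|right]; split; try exact: hu2;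
    clear - hu1 xu; lra.
  have [xl|xl] := ltP x (- eta).
    have x0 : x <= 0 by clear - xl eta0; lra.
    rewrite (tspline_left _ kU) ?(ltW xl)// add0r.
    have p1x : 0 <= p1.[x] by apply: p10; rewrite x1.
    have [xu|xu] := boolP ((x <= u) || (u + l <= x)).
      by rewrite addr_ge0//; case: (sC1 x xu).
    have := sC2 x; rewrite negb_or -!ltNge in xu.
    have [|[_ h]|[h _]] := Jw; first by clear - xu; lra.
      by clear - h; lra.
    have h0 : 0 <= u by case: hu => -[hu1 _]; clear - hu1 l0 h x0 eta0 xl; lra.
    by clear - h0 xl xu eta0; lra.
  have [xr|xr] := ltP eta x.
    have x0 : 0 <= x by clear - xr eta0; lra.
    rewrite (tspline_right _ kU) ?(ltW xr)// pU E12 addrA addrCA subrr addr0.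
    have p2x : 0 <= p2.[x] by apply: p20; rewrite x0.
    have [xu|xu] := boolP ((x <= u) || (u + l <= x)).
      by rewrite addr_ge0//; case: (sC1 x xu).
    have := sC2 x; rewrite negb_or -!ltNge in xu.
    have [|[h _]|[_ h]] := Jw; first by clear - xu; lra.
      by clear - h xr eta0; lra.
    by clear - h; lra.
  have xu : (x <= u) || (u + l <= x).
    by case: hu => -[hu1 _]; apply/orP; [right|left]; clear - hu1 xl xr eta1; lra.
  have [_ h] := sC1 x xu; have {}h := h ltac:(by rewrite xl xr).
  have := sU x ltac:(by rewrite x1 x2); rewrite ler_norml => sUx.
  have [x0|x0] := leP x 0.
    have p1x : 0 <= p1.[x] by apply: p10; rewrite x1.
    by clear - p1x sUx h EK Nb; lra.
  have p2x : 0 <= p2.[x] by apply: p20; rewrite x2 ltW.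
  have := horner_bound sp'' hk (_ : `|x| <= 1); rewrite -/N -/b ler_norml x1 x2 => /(_ isT).
  rewrite E12 ler_norml => hpx.
  by clear - p2x sUx h EK hpx; lra.
- move=> x x1; rewrite E (le_trans (ler_normD _ _))//.
  have h1 := sU x x1; have h2 := sC3 x.
  have h3 : 0 <= (CU + (CU + N) + c) * (M * B - b).
    by rewrite mulr_ge0 ?subr_ge0//; clear - CU0 CN0 c0; lra.
  rewrite /C mulrDl; clear - h1 h2 h3 dB K00 w0 CUb.
  have Es : (CU + (CU + N) + c) * b = CU * b + K0 + w by rewrite /K0 /w; ring.
  rewrite (_ : 50 * (CU + (CU + N) + c) * M * B = 50 * ((CU + (CU + N) + c) * (M * B)));
    last by ring.
  rewrite mulrBr Es in h3.
  move: h3; set X := _ * (M * B); lra.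
Qed.

End PositiveBlending.

(** * Transport from [-1, 1] to the neighbourhood of a knot *)

Section Local.
Context {R : realType}.
Implicit Types (a b c d h l w x z eps eta B C : R) (p q : {poly R}) (L : seq (R * R)) (K : seq R).

Lemma poly_primitive m p B : (size p <= m)%N -> coef_bound p B ->
  exists P : {poly R}, [/\ P^`() = p, P.[0] = 0, (size P <= m.+1)%N & coef_bound P B].
Proof.
move=> sp pB; have B0 := coef_bound_ge0 pB.
(* the coefficient of degree 0 is [p`_0 / 0 = 0] *)
exists (\poly_(i < m.+1) (p`_i.-1 / i%:R)); split.
- apply/polyP => i; rewrite coef_deriv coef_poly ltnS.
  have [im|mi] := ltnP i m; first by rewrite -[LHS]mulr_natr divfK ?pnatr_eq0.
  by rewrite mul0rn nth_default// (leq_trans sp).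
- by rewrite horner_coef0 coef_poly /= invr0 mulr0.
- exact: size_poly.
- move=> i; rewrite coef_poly; case: (i < m.+1)%N; last by rewrite normr0.
  case: i => [|i] /=; first by rewrite invr0 mulr0 normr0.
  rewrite normrM normfV normr_nat ler_pdivrMr ?ltr0n//.
  by rewrite (le_trans (pB i))// ler_peMr// ler1n.
Qed.

Lemma primitive_bound n L C : (forall u : R * R, u \in L -> -1 <= u.2) ->
  (forall x, -1 <= x <= 1 -> `|tspline n.+1 L x| <= C) ->
  forall x, -1 <= x <= 1 -> `|tspline n.+2 L x| <= 2 * C.
Proof.
move=> hL hC x /andP[x1 x2].
have F0 : tspline n.+2 L (-1) = 0.
  rewrite /tspline big_seq big1// => u /hL u1; rewrite /tpower; case: ifP => [u2|_]; last by rewrite mulr0.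
  have -> : u.2 = -1 by lra.
  by rewrite subrr expr0n /= mul0r mulr0.
have C0 : 0 <= C by apply: le_trans (hC 0 _) => //; lra.
rewrite -[tspline n.+2 L x]subr0 -F0.
apply: (le_trans (derive_le_dist (is_derive_tspline n L) x1 _)).
  by move=> y /andP[y1 y2]; apply: hC; lra.
by rewrite mulrC ler_wpM2r//; lra.
Qed.

(** What q-monotonicity imposes on the jump at a knot: the q-th derivative, as a measure, has there
    a nonnegative atom and no worse singularity. *)
Definition jump_condition (q : nat) (p : {poly R}) (z : R) : Prop :=
  if q == 1%N then (0 <= p.[z] : Prop) else p.[z] = 0 /\ 0 <= p^`().[z].

Lemma normalized_blending n : exists eps C, [/\ 0 < eps, 0 < C & forall k K,
  k = 1%N \/ k = 2%N ->
  dense K eps (-1) 1 -> forall p1 p2 B,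
  (size p1 <= (k + n.+1).+1)%N -> (size p2 <= (k + n.+1).+1)%N ->
  jump_condition k (p2 - p1) 0 ->
  (forall x, -1 <= x <= 0 -> 0 <= p1^`(k).[x]) ->
  (forall x, 0 <= x <= 1 -> 0 <= p2^`(k).[x]) -> coef_bound (p2 - p1) B ->
  exists L, [/\ knots_in K (-1) 1 L, tpoly (k + n.+1) L = p2 - p1,
    forall x, -1 <= x <= 1 -> 0 <= p1^`(k).[x] + tspline n.+1 L x &
    forall x, -1 <= x <= 1 -> `|tspline (k + n.+1) L x| <= C * B]].
Proof.
have [eps [C [eps0 C0 H]]] := @positive_blending R n.
(* Each primitive on [-1, 1] costs a factor 2, and two are taken when [k] is 2. *)
exists eps, (4 * C); split=> //; first exact: mulr_gt0.
move=> k K [] -> dK p1 p2 B s1 s2; rewrite /jump_condition /= => hj p10 p20 pB.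
- rewrite ?add1n ?derivn1 in s1 s2 p10 p20 *.
  have sD : (size (p2 - p1)%R <= n.+3)%N.
    by rewrite (leq_trans (size_polyD _ _))// size_polyN geq_max s1 s2.
  have B0 := coef_bound_ge0 pB.
  have [P [P1 P0 sP PB]] := poly_primitive sD pB.
  have [||||L [kL pL sL bL]] := H K dK p1^`() p2^`() P B _ _ sP _ P0 _ p10 p20 PB.
  + exact: size_deriv_le.
  + exact: size_deriv_le.
  + by rewrite P1 derivB.
  + by rewrite P1.
  exists L; split=> //.
    by rewrite -deriv_tpoly pL P1.
  move=> x x1; apply: (le_trans (primitive_bound _ bL x1)).
    by move=> u /kL[_ /andP[]].
  by rewrite mulrA ler_wpM2r// ler_pM2r//; lra.
- rewrite ?add2n ?derivSn ?derivn1 ?derivn0 in s1 s2 p10 p20 *.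
  have sD : (size (p2 - p1)%R <= n.+4)%N.
    by rewrite (leq_trans (size_polyD _ _))// size_polyN geq_max s1 s2.
  have B0 := coef_bound_ge0 pB; case: hj => hj1 hj2.
  have [|||L [kL pL sL bL]] := H K dK p1^`()^`() p2^`()^`() (p2 - p1) B _ _ sD _ hj1 hj2 p10 p20 pB.
  + by apply: size_deriv_le; exact: size_deriv_le.
  + by apply: size_deriv_le; exact: size_deriv_le.
  + by rewrite !derivB.
  exists L; split=> //.
  have kL' (u : R * R) : u \in L -> -1 <= u.2 by move=> /kL[_ /andP[]].
  move=> x x1; apply: (le_trans (primitive_bound kL' (primitive_bound kL' bL) x1)).
  by rewrite le_eqVlt; apply/orP; left; apply/eqP; ring.
Qed.

Definition affine (z h : R) : {poly R} := h *: 'X + z%:P.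

Lemma horner_affine z h x : (affine z h).[x] = z + h * x.
Proof. by rewrite hornerD hornerZ hornerX hornerC addrC. Qed.

Lemma deriv_affine z h : (affine z h)^`() = h%:P.
Proof. by rewrite derivD derivZ derivX derivC addr0 alg_polyC. Qed.

Lemma derivn_comp_affine k p z h :
  (p \Po affine z h)^`(k) = h ^+ k *: (p^`(k) \Po affine z h).
Proof.
elim: k => [|k IHk]; first by rewrite !derivn0 expr0 scale1r.
rewrite derivnS IHk derivZ deriv_comp deriv_affine.
by rewrite -derivnS mulrC mul_polyC scalerA exprSr.
Qed.

Lemma size_comp_affine m p z h : 0 < h -> (size p <= m)%N ->
  (size (p \Po affine z h) <= m)%N.
Proof.
move=> h0 sp; rewrite size_comp_poly2// /affine.
by rewrite size_polyDl size_scale ?size_polyX ?gt_eqF// (leq_ltn_trans (size_polyC_leq1 _)).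
Qed.

Lemma comp_affineK p z h : h != 0 -> (p \Po affine z h) \Po affine (- z / h) h^-1 = p.
Proof.
move=> h0; rewrite -comp_polyA (_ : affine z h \Po _ = 'X) ?comp_polyXr//.
rewrite [X in X \Po _]/affine comp_polyD comp_polyZ comp_polyX comp_polyC /affine.
rewrite scalerDr scalerA divff// scale1r -mul_polyC -polyCM mulrCA divff// mulr1.
by rewrite -addrA -polyCD addNr addr0.
Qed.

(** Dividing by [h ^+ m] makes the spline of degree [m] keep its values under the change of
    variable; in degree [k] a factor h^k / h^m remains. *)
Definition rescale m z h L : seq (R * R) := [seq (u.1 / h ^+ m, z + h * u.2) | u <- L].

Lemma tspline_rescale k m z h L x : 0 < h ->
  tspline k (rescale m z h L) (z + h * x) = h ^+ k / h ^+ m * tspline k L x.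
Proof.
move=> h0; rewrite /tspline big_map mulr_sumr; apply: eq_bigr => u _ /=.
rewrite /tpower lerD2l ler_pM2l//; case: ifP => _; last by rewrite !mulr0.
by rewrite (_ : z + h * x - _ = h * (x - u.2)) ?exprMn; ring.
Qed.

Lemma tpoly_rescale m z h L : h != 0 ->
  tpoly m (rescale m z h L) \Po affine z h = tpoly m L.
Proof.
move=> h0; rewrite /tpoly big_map raddf_sum; apply: eq_bigr => u _ /=.
rewrite comp_polyZ rmorphXn /= comp_polyB comp_polyX comp_polyC.
rewrite (_ : affine z h - _ = h *: ('X - u.2%:P)); last first.
  by rewrite /affine scalerBr polyCD polyCM -mul_polyC -[h *: u.2%:P]mul_polyC; ring.
rewrite exprZn scalerA; congr (_ *: _).
by rewrite mulrAC divfK// expf_neq0.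
Qed.

(** [eps] and [C] survive the change of variable: density is relative to [h], the jump is measured
    by its coefficients after composition with [affine z h], and the sign of a k-th derivative
    ignores the factor h^k. *)
Lemma local_blending n : exists eps C, [/\ 0 < eps, 0 < C & forall k K z h,
  k = 1%N \/ k = 2%N -> 0 < h ->
  dense K (eps * h) (z - h) (z + h) -> forall p1 p2 B,
  (size p1 <= (k + n.+1).+1)%N -> (size p2 <= (k + n.+1).+1)%N ->
  jump_condition k (p2 - p1) z ->
  (forall x, z - h <= x <= z -> 0 <= p1^`(k).[x]) ->
  (forall x, z <= x <= z + h -> 0 <= p2^`(k).[x]) ->
  coef_bound ((p2 - p1) \Po affine z h) B ->
  exists L, [/\ knots_in K (z - h) (z + h) L, tpoly (k + n.+1) L = p2 - p1,
    forall x, z - h <= x <= z + h -> 0 <= p1^`(k).[x] + tspline n.+1 L x &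
    forall x, z - h <= x <= z + h -> `|tspline (k + n.+1) L x| <= C * B]].
Proof.
have [eps [C [eps0 C0 H]]] := normalized_blending n.
exists eps, C; split=> // k K z h hk h0 dK p1 p2 B s1 s2 hj p10 p20 pB.
have hn0 : h != 0 by rewrite gt_eqF.
pose K' := [seq (t - z) / h | t <- K].
have dK' : dense K' eps (-1) 1.
  move=> c c1 c2; have [||t tK tc] := dK (z + h * c).
  - have : 0 <= h * (c + 1) by rewrite mulr_ge0//; lra.
    by lra.
  - have : 0 <= h * (1 - c - eps) by rewrite mulr_ge0//; lra.
    by lra.
  exists ((t - z) / h); first by apply/mapP; exists t.
  by rewrite ler_pdivlMr// ler_pdivrMr//; lra.
have sc p : (size p <= (k + n.+1).+1)%N -> (size (p \Po affine z h) <= (k + n.+1).+1)%N.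
  exact: size_comp_affine.
have hx x : x = z + h * ((x - z) / h) by field.
have in1 x : -1 <= x <= 1 -> z - h <= z + h * x <= z + h.
  move=> x1; have : 0 <= h * (1 - x) by rewrite mulr_ge0//; lra.
  have : 0 <= h * (1 + x) by rewrite mulr_ge0//; lra.
    by lra.
have [||||L [kL pL sL bL]] := H k K' hk dK' (p1 \Po affine z h) (p2 \Po affine z h) B (sc _ s1) (sc _ s2).
- rewrite -comp_polyB; move: hj; rewrite /jump_condition.
  rewrite deriv_comp hornerM !horner_comp horner_affine mulr0 addr0.
  rewrite deriv_affine hornerC.
  by case: ifP => // _ [h1 h2]; split=> //; rewrite mulr_ge0// ltW.
- move=> x x1; rewrite derivn_comp_affine hornerZ horner_comp horner_affine.
  rewrite mulr_ge0 ?exprn_ge0 ?(ltW h0)// p10//.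
  have /andP[-> _] : z - h <= z + h * x <= z + h by apply: in1; lra.
  have : 0 <= h * (- x) by rewrite mulr_ge0//; lra.
    by lra.
- move=> x x1; rewrite derivn_comp_affine hornerZ horner_comp horner_affine.
  rewrite mulr_ge0 ?exprn_ge0 ?(ltW h0)// p20//.
  have /andP[_ ->] : z - h <= z + h * x <= z + h by apply: in1; lra.
  by rewrite lerDl mulr_ge0 ?(ltW h0)//; lra.
- by rewrite -comp_polyB.
exists (rescale (k + n.+1) z h L); split.
- move=> u /mapP[v /kL[/mapP[t tK Et] v1] ->] /=; split; last exact: in1.
  by rewrite Et -hx.
- rewrite -[LHS](comp_affineK _ z hn0) tpoly_rescale// pL -comp_polyB.
  by rewrite comp_affineK.
- move=> x x1; rewrite [x]hx tspline_rescale//; set y := _ / h.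
  have y1 : -1 <= y <= 1 by rewrite /y ler_pdivlMr// ler_pdivrMr//; lra.
  have := sL y y1; rewrite derivn_comp_affine hornerZ horner_comp horner_affine => h1.
  have Eh : h ^+ n.+1 / h ^+ (k + n.+1) = (h ^+ k)^-1.
    by rewrite exprD invfM mulrCA divff ?mulr1// expf_neq0.
  rewrite Eh -(pmulr_rge0 _ (exprn_gt0 k h0)) mulrDr [X in _ + X]mulrA.
  by rewrite divff ?mul1r// expf_neq0.
- move=> x x1; rewrite [x]hx tspline_rescale//; set y := _ / h.
  have y1 : -1 <= y <= 1 by rewrite /y ler_pdivlMr// ler_pdivrMr//; lra.
  by rewrite divff ?expf_neq0// mul1r; exact: bL.
Qed.

End Local.

(** * Norms and the modulus of smoothness *)

Section Norms.
Context {R : realType}.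
Notation mu := (@lebesgue_measure R).
Implicit Types (p : \bar R) (M len : R) (A : set R) (f g : R -> \bar R).

(* No measurability is needed, since the integral of a nonnegative function is a
   supremum over simple functions. *)
Lemma integral_le_nomeas f g : (forall x, 0 <= f x)%E -> (forall x, f x <= g x)%E ->
  (\int[mu]_x f x <= \int[mu]_x g x)%E.
Proof.
move=> f0 fg; have g0 x : (0 <= g x)%E by apply: le_trans (fg x).
rewrite !ge0_integralE// !patch_setT.
apply: ereal_sup_le => _ /= [h hf <-]; exists h => // x.
exact: le_trans (hf x) (fg x).
Qed.

Lemma le_Lnorm p f g : (0 < p)%E -> (forall x, `|f x| <= `|g x|)%E ->
  ('N[mu]_p[f] <= 'N[mu]_p[g])%E.
Proof.
move=> p0 fg; rewrite unlock; case: p p0 => [r|_|//].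
- rewrite lte_fin => r0; apply: gt0_ler_poweR.
  + by rewrite invr_ge0 ltW.
  + by rewrite in_itv /= leey andbT; apply: integral_ge0 => x _; exact: poweR_ge0.
  + by rewrite in_itv /= leey andbT; apply: integral_ge0 => x _; exact: poweR_ge0.
  apply: integral_le_nomeas => x; first exact: poweR_ge0.
  apply: gt0_ler_poweR; rewrite ?(ltW r0)// in_itv /= leey abse_ge0//.
- case: ifP => // _; apply: le_ess_sup; exact: nearW.
Qed.

(** The norm of [M] times the indicator of a set of measure [len]. For [p = +oo] this is exact only
    if [len] is positive, hence separate upper and lower estimates below. *)
Definition indic_norm p M len : R := if p is r%:E then M * len `^ r^-1 else M.

Definition step_fun M A : R -> \bar R := EFin \o (fun x => M * \1_A x).

Lemma Lnorm_step_fin (r : R) M len A : 0 < r -> measurable A -> mu A = len%:E ->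
  0 <= M -> 0 <= len -> ('N[mu]_r%:E[step_fun M A] = (indic_norm r%:E M len)%:E)%E.
Proof.
move=> r0 mA muA M0 len0; rewrite unlock /indic_norm.
have rn0 : r != 0 by rewrite gt_eqF.
under eq_integral => x _.
  rewrite (_ : _ `^ _ = ((M `^ r)%:E * (\1_A x)%:E))%E; last first.
    rewrite /step_fun /=. rewrite -EFinM; congr EFin.
    rewrite ger0_norm ?mulr_ge0// powRM//; congr (_ * _).
    by rewrite indicE; case: (x \in A); [rewrite powR1|rewrite powR0].
  over.
rewrite ge0_integralZl//; last 2 first.
- by apply/measurable_EFinP; exact: measurable_indic.
- by rewrite lee_fin powR_ge0.
rewrite integral_indic// setIT [X in (_ * X)%E](_ : _ = len%:E)// -EFinM poweR_EFin; congr EFin.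
by rewrite powRM ?powR_ge0// -powRrM mulfV// powRr1.
Qed.

Lemma Lnorm_step_le p M len A : (0 < p)%E -> measurable A -> mu A = len%:E ->
  0 <= M -> 0 <= len -> ('N[mu]_p[step_fun M A] <= (indic_norm p M len)%:E)%E.
Proof.
move=> p0 mA muA M0 len0; case: p p0 => [r|_|//].
  by rewrite lte_fin => r0; rewrite (Lnorm_step_fin r0 mA muA).
rewrite unlock /indic_norm; case: ifP => _; last by rewrite lee_fin.
apply/ess_supP; apply: nearW => x /=; rewrite lee_fin ger0_norm ?mulr_ge0//.
by rewrite indicE; case: (x \in A); rewrite ?mulr1 ?mulr0.
Qed.

Lemma Lnorm_step_ge p M len A : (0 < p)%E -> measurable A -> mu A = len%:E ->
  0 <= M -> 0 < len -> ((indic_norm p M len)%:E <= 'N[mu]_p[step_fun M A])%E.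
Proof.
move=> p0 mA muA M0 len0; case: p p0 => [r|_|//].
  by rewrite lte_fin => r0; rewrite (Lnorm_step_fin r0 mA muA)// ltW.
rewrite unlock /indic_norm ifT; last first.
  by apply: (@lt_le_trans _ _ (mu A)); [by rewrite muA lte_fin|apply: le_measure; rewrite ?inE//].
rewrite leNgt; apply/negP => h.
have /ess_supP[N [mN N0 hN]] : (ess_sup mu (abse \o step_fun M A) <= ess_sup mu (abse \o step_fun M A))%E by [].
suff : (mu A <= mu N)%E by rewrite N0 muA lee_fin leNgt len0.
apply: le_measure; rewrite ?inE// => x Ax; apply: hN => /= hx.
move: h; rewrite ltNge => /negP; apply; apply: le_trans hx.
by rewrite indicE mem_set// mulr1 lee_fin ler_norm.
Qed.

Lemma Lnorm_ae0 p f (e : R) : (0 < p)%E -> (forall x, x != e -> f x = 0)%E ->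
  (forall x, f x \is a fin_num) -> ('N[mu]_p[f] <= 0)%E.
Proof.
move=> p0 f0 ff; have mue : mu [set e] = 0%:E by rewrite lebesgue_measure_set1.
case: p p0 => [r r0|_|//].
  apply: (le_trans (le_Lnorm (g := step_fun (fine `|f e|) [set e]) r0 _)).
    move=> x; rewrite /step_fun /=; have [->|xe] := eqVneq x e.
      by rewrite indicE mem_set//= mulr1 ger0_norm ?fine_ge0// fineK ?abse_fin_num.
    by rewrite f0// abse0.
  apply: (le_trans (Lnorm_step_le r0 _ mue _ _)) => //.
  by rewrite /indic_norm powR0 ?mulr0// invr_neq0// gt_eqF.
rewrite unlock; case: ifP => // _; apply/ess_supP.
exists [set e]; split=> // x /= hx; apply: contrapT => /eqP xe; apply: hx.
by rewrite f0// abse0.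
Qed.

End Norms.

(** * The modulus of smoothness detects the jump at a knot *)

Section Differences.
Context {R : realType}.
Notation mu := (@lebesgue_measure R).
Implicit Types (h x z B C : R) (q : {poly R}) (f : R -> R) (J : set R) (p : \bar R).

Lemma sum_difference_rec m (F : nat -> R) :
  \sum_(i < m.+2) 'C(m.+1, i)%:R * (-1) ^+ (m.+1 - i) * F i =
  \sum_(i < m.+1) 'C(m, i)%:R * (-1) ^+ (m - i) * (F i.+1 - F i).
Proof.
under [RHS]eq_bigr do rewrite mulrBr.
rewrite sumrB big_ord_recl.
under eq_bigr => i _ do
  rewrite lift0 binS natrD !mulrDl subSS.
rewrite big_split /= addrA addrC; congr (_ + _).
rewrite [X in _ + X = _]big_ord_recr /= (@bin_small m m.+1)// !mul0r addr0.
rewrite [in RHS]big_ord_recl opprD -sumrN; congr (_ + _).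
  by rewrite !bin0 !subn0 exprS; ring.
apply: eq_bigr => i _; rewrite lift0 subnS -mulNr -mulrN; congr (_ * _ * _).
by rewrite -[(m - i)%N]prednK ?subn_gt0// exprS mulN1r.
Qed.

Lemma sum_difference_poly m q x h : (size q <= m)%N ->
  \sum_(i < m.+1) 'C(m, i)%:R * (-1) ^+ (m - i) * q.[x + i%:R * h] = 0.
Proof.
elim: m q => [|m IHm] q sq.
  have /eqP -> : q == 0 by rewrite -size_poly_eq0 -leqn0.
  by rewrite big1// => i _; rewrite horner0 mulr0.
rewrite (sum_difference_rec m (fun i => q.[x + i%:R * h])).
(* The forward difference cancels the leading coefficient, so the induction hypothesis applies to
   [q']. *)
pose q' := q \Po ('X + h%:P) - q.
transitivity (\sum_(i < m.+1) 'C(m, i)%:R * (-1) ^+ (m - i) * q'.[x + i%:R * h]).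
  apply: eq_bigr => i _; congr (_ * _).
  rewrite hornerD hornerN horner_comp hornerD hornerX hornerC; congr (_.[_] - _).
  by rewrite -natr1; ring.
apply: IHm; rewrite /q'.
have [->|q0] := eqVneq q 0; first by rewrite comp_poly0 subrr size_poly0.
have sc : size (q \Po ('X + h%:P)) = size q by rewrite size_comp_poly2// size_XaddC.
have lc : lead_coef (q \Po ('X + h%:P)) = lead_coef q.
  by rewrite lead_coef_comp ?size_XaddC// lead_coefXaddC expr1n mulr1.
apply/leq_sizeP => i mi; rewrite coefB.
have [ei|ni] := eqVneq i (size q).-1.
  by rewrite ei -{1}sc -!lead_coefE lc subrr.
have si : (size q <= i)%N.
  rewrite leqNgt; apply: contra ni => iq; have q1 : (0 < size q)%N by rewrite size_poly_gt0.
  by rewrite eqn_leq -[X in X && _]ltnS -[X in _ && X]ltnS !prednK// iq (leq_trans sq).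
by rewrite !nth_default ?subrr// sc.
Qed.

Lemma Delta_jump m h z f J (P1 P2 : {poly R}) x : 0 < h ->
  (size P1 <= m)%N ->
  J (x - m%:R * h / 2) -> J (x + m%:R * h / 2) ->
  z < x + m%:R * h / 2 < z + h ->
  (forall t : R, z - m%:R * h < t < z -> f t = P1.[t]) ->
  (forall t : R, z < t < z + h -> f t = P2.[t]) ->
  Delta m h f J x = (P2 - P1).[x + m%:R * h / 2].
Proof.
move=> h0 s1 J1 J2 y1 f1 f2.
rewrite /Delta asboolT// big_ord_recr /= binn subnn expr0 !mul1r.
set y := x + m%:R * h / 2 in y1 *.
have Ey : x - m%:R * h / 2 + m%:R * h = y by rewrite /y; lra.
rewrite Ey f2// hornerD hornerN addrC; congr (_ + _).
have := sum_difference_poly (x - m%:R * h / 2) h s1.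
rewrite big_ord_recr /= binn subnn expr0 !mul1r Ey => /eqP; rewrite addr_eq0 => /eqP <-.
apply: eq_bigr => i _; congr (_ * _); apply: f1.
have : (0 : R) <= i%:R * h by rewrite mulr_ge0// ltW.
have : (i%:R + 1) * h <= m%:R * h by rewrite ler_pM2r// natr1 ler_nat.
by move: y1; rewrite /y; lra.
Qed.

Lemma modulus_ge_jump m : exists c l : R, [/\ 0 < c, 0 < l &
  forall p z h (a b : R) f (P1 P2 : {poly R}), (0 < p)%E -> 0 < h ->
  (size P1 <= m.+1)%N -> (size P2 <= m.+1)%N ->
  a <= z - m.+1%:R * h -> z + h <= b ->
  (forall t : R, a < t < z -> f t = P1.[t]) ->
  (forall t : R, z < t < b -> f t = P2.[t]) ->
  forall k, ((indic_norm p (c * `|((P2 - P1) \Po affine z h)`_k|) (h * l))%:E <=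
    modulusJ m.+1 f `[a, b] p)%E].
Proof.
have [|||c [l [c0 l0 hl]]] := @large_on_subinterval R m (1 / 4) (3 / 4); [lra|lra|lra|].
exists c, l; split=> // p z h a b f P1 P2 p0 h0 s1 s2 az zb f1 f2 k.
set D := (P2 - P1) \Po affine z h.
have sD : (size D <= m.+1)%N.
  apply: size_comp_affine => //.
  by rewrite (leq_trans (size_polyD _ _))// size_polyN geq_max s2 s1.
have [u [u1 u2 hu]] := hl D sD.
set B := `|_|; pose M : R := m.+1%:R.
have M1 : 1 <= M by rewrite ler1n.
have hM : h <= M * h by rewrite ler_peMl// ltW.
have hab : h <= b - a by rewrite -/M in az; lra.
have ab : a < b by lra.
apply: (@le_trans _ _ (Lpnorm p `[a, b] (Delta m.+1 h f `[a, b]))); last first.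
  apply: ereal_sup_ubound => /=; exists h => //=.
  rewrite lebesgue_measure_itv/= lte_fin ab /= h0 /=.
  by rewrite hab.
(* The centres whose last node runs over z + h [u, u + l]; as [u, u + l] lies in [1/4, 3/4], that
   node stays off z and z + h. *)
pose A : set R := `[z + h * u - M * h / 2, z + h * u - M * h / 2 + h * l]%classic.
have hl0 : 0 < h * l by rewrite mulr_gt0.
have muA : mu A = (h * l)%:E.
  rewrite lebesgue_measure_itv/= lte_fin ltrDl hl0 -EFinD; congr EFin; lra.
have B0 : 0 <= B by exact: normr_ge0.
have cB0 : 0 <= c * B by rewrite mulr_ge0// ltW.
have mA : measurable A by exact: measurable_itv.
apply: (le_trans (Lnorm_step_ge p0 mA muA cB0 hl0)).
apply: le_Lnorm => // x; rewrite /step_fun /= indicE.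
have [xA|xA] := boolP (x \in A); last by rewrite mulr0 normr0 abse_ge0.
move: xA; rewrite inE /A /= in_itv /= => /andP[x1 x2].
have hu0 : 0 < h * u by rewrite mulr_gt0//; lra.
have hul : 0 < h * (1 - u - l) by rewrite mulr_gt0//; lra.
have y1 : z < x + M * h / 2 < z + h by lra.
have J1 : `[a, b]%classic (x - M * h / 2) by rewrite /= in_itv /=; rewrite -/M in az; lra.
have J2 : `[a, b]%classic (x + M * h / 2) by rewrite /= in_itv /=; rewrite -/M in az; lra.
have J3 : `[a, b]%classic x by rewrite /= in_itv /=; rewrite -/M in az; lra.
rewrite patchE mem_set//= (@Delta_jump m.+1 h z f _ P1 P2 x)//; last 2 first.
- by move=> t t1; apply: f1; rewrite -/M in az t1; lra.
- by move=> t t1; apply: f2; lra.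
rewrite mulr1 lee_fin ger0_norm; last by rewrite mulr_ge0// ltW.
pose v := (x + M * h / 2 - z) / h.
have Ev : x + M * h / 2 = z + h * v by rewrite /v; field; rewrite gt_eqF.
rewrite -/M Ev -horner_affine -horner_comp; apply: hu.
by rewrite /v ler_pdivlMr// ler_pdivrMr//; lra.
Qed.

(** Both norms are over lengths proportional to [h], so [h] cancels and [p] enters the constant only
    through (2 / l)^(1 / p). *)
Lemma indic_norm_ratio p (C c B h l : R) : 0 < c -> 0 < l -> 0 < h -> 0 <= B -> 0 <= C ->
  indic_norm p (C * B) (2 * h) =
  C / c * indic_norm p 1 (2 / l) * indic_norm p (c * B) (h * l).
Proof.
move=> c0 l0 h0 B0 C0; have cn : c != 0 by rewrite gt_eqF.
have ln : l != 0 by rewrite gt_eqF.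
rewrite /indic_norm; case: p => [r||]; rewrite ?mulr1 ?mul1r; [|by field..].
rewrite (_ : 2 * h = (2 / l) * (h * l)); last by field.
rewrite [(2 / l * _) `^ _]powRM ?divr_ge0 ?mulr_ge0 ?ltW//; by field.
Qed.

End Differences.

(** * Local consequences of q-monotonicity *)

Section PolynomialShape.
Context {R : realType}.
Implicit Types (a b x y w z : R) (p P : {poly R}) (f g : R -> R).

(** [x] may be an endpoint. Negativity is moved to a window inside the open interval, where
    hypotheses on a piece of a function are available; this drives the proofs by contradiction
    below. *)
Lemma poly_lt0_subitv p a b x : a < b -> a <= x <= b -> p.[x] < 0 ->
  exists u v (e : R), [/\ a < u, u < v, v < b, 0 < e & forall y, u <= y <= v -> p.[y] <= - e].
Proof.
move=> ab xab px; pose e := - p.[x] / 2.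
have e0 : 0 < e by rewrite /e; lra.
have cp : {for x, continuous (horner p)} by exact: continuous_horner.
have : \forall y \near x, p.[y] < - e.
  by apply: (cvgr_lt _ cp); rewrite /e; lra.
move=> /nbhs_ballP[d /= d0 hd].
pose d' := Num.min d (b - a) / 8.
have m0 : 0 < Num.min d (b - a) by rewrite lt_min d0 subr_gt0.
have m1 : Num.min d (b - a) <= d by rewrite ge_min lexx.
have m2 : Num.min d (b - a) <= b - a by rewrite ge_min lexx orbT.
have hb y : `|x - y| < d -> p.[y] <= - e by move=> h; apply/ltW/hd.
have [h|h] := leP x ((a + b) / 2).
  exists (x + d'), (x + 2 * d'), e; rewrite /d'; split; try lra.
  by move=> y yy; apply: hb; rewrite distrC ger0_norm; lra.
exists (x - 2 * d'), (x - d'), e; rewrite /d'; split; try lra.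
by move=> y yy; apply: hb; rewrite ger0_norm; lra.
Qed.

Lemma poly_ge0_closure p a b : a < b -> (forall x, a < x < b -> 0 <= p.[x]) ->
  forall x, a <= x <= b -> 0 <= p.[x].
Proof.
move=> ab p0 x xab; rewrite leNgt; apply/negP => px.
have [u [v [e [au uv vb e0 h]]]] := poly_lt0_subitv ab xab px.
by have := p0 u ltac:(lra); have := h u ltac:(lra); lra.
Qed.

Lemma poly_ge0_deriv0 p b : 0 < b -> (forall x, 0 < x < b -> 0 <= p.[x]) ->
  p.[0] = 0 -> 0 <= p^`().[0].
Proof.
move=> b0 p0 pz; have /factor_theorem[q Eq] : root p 0 by rewrite rootE pz.
rewrite Eq derivM derivXsubC mulr1 hornerD hornerM hornerXsubC subrr mulr0 add0r.
apply: (poly_ge0_closure b0); last by rewrite lexx ltW.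
move=> x x0; have := p0 x x0; rewrite Eq hornerM hornerXsubC subr0 pmulr_lge0//.
by case/andP: x0.
Qed.

Lemma poly_slope_le p a b c : a <= b -> (forall x, a <= x <= b -> p^`().[x] <= c) ->
  p.[b] - p.[a] <= c * (b - a).
Proof.
move=> ab h.
have := @derive_le_sub R (horner p) (horner (c *: 'X)) (horner p^`()) (horner (c *: 'X)^`()) a b
  (is_derive_poly p) (is_derive_poly (c *: 'X)) ab.
rewrite !hornerZ !hornerX -mulrBr; apply => y yab.
by rewrite derivZ derivX hornerZ hornerC mulr1; exact: h.
Qed.

Lemma poly_deriv_ge0 p a b : a < b ->
  (forall x y, a < x -> x < y -> y < b -> p.[x] <= p.[y]) ->
  forall x, a <= x <= b -> 0 <= p^`().[x].
Proof.
move=> ab mono x xab; rewrite leNgt; apply/negP => px.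
have [u [v [e [au uv vb e0 h]]]] := poly_lt0_subitv ab xab px.
have h1 := mono u v au uv vb.
have h2 := poly_slope_le (ltW uv) h.
have : 0 < e * (v - u) by rewrite mulr_gt0// subr_gt0.
lra.
Qed.

Lemma poly_slope_ge p a b c : a <= b -> (forall x, a <= x <= b -> c <= p^`().[x]) ->
  c * (b - a) <= p.[b] - p.[a].
Proof.
move=> ab h; have := @poly_slope_le (- p) a b (- c) ab.
rewrite !hornerN derivN mulNr => H.
suff : - p.[b] - - p.[a] <= - (c * (b - a)) by lra.
by apply: H => // x xab; rewrite hornerN lerN2 h.
Qed.

Lemma poly_deriv2_ge0 p a b : a < b ->
  (forall x y w, a < x -> x < y -> y < w -> w < b ->
    (p.[y] - p.[x]) * (w - y) <= (p.[w] - p.[y]) * (y - x)) ->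
  forall x, a <= x <= b -> 0 <= p^`()^`().[x].
Proof.
move=> ab conv x xab; rewrite leNgt; apply/negP => px.
have [u [v [e [au uv vb e0 h]]]] := poly_lt0_subitv ab xab px.
have sl s t : u <= s -> s <= t -> t <= v -> p^`().[t] <= p^`().[s] - e * (t - s).
  move=> us st tv; suff : p^`().[t] - p^`().[s] <= - e * (t - s) by lra.
  by apply: poly_slope_le => // y yy; apply: h; lra.
(* With [c] the derivative at [m], the slope over [m, v] is at most [c] and that over [u, m] is
   larger; the point [w] serves to make the second comparison strict. *)
pose m := (u + v) / 2; pose w := (u + m) / 2.
have wE : w = (3 * u + v) / 4 by rewrite /w /m; lra.
set c := p^`().[m].
have h1 : p.[v] - p.[m] <= c * (v - m).
  apply: poly_slope_le; first by rewrite /m; lra.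
  move=> y /andP[my yv]; apply: (le_trans (sl m y _ my yv)); first by rewrite /m; lra.
  by rewrite gerBl mulr_ge0 ?subr_ge0// ltW.
have h2 : c * (m - w) <= p.[m] - p.[w].
  apply: poly_slope_ge; first by rewrite wE /m; lra.
  move=> y /andP[wy ym]; have := sl y m _ ym; rewrite -/c => /(_ _ _)/le_trans; apply.
  - by rewrite wE in wy; lra.
  - by rewrite /m; lra.
  - by rewrite gerBl mulr_ge0 ?subr_ge0// ltW.
have h3 : (c + e * (m - w)) * (w - u) <= p.[w] - p.[u].
  apply: poly_slope_ge; first by rewrite wE; lra.
  move=> y /andP[uy yw]; have ym : y <= m by rewrite /m; rewrite wE in yw; lra.
  have := sl y m uy ym ltac:(rewrite /m; lra); rewrite -/c => hc.
  have : 0 <= e * (w - y) by rewrite mulr_ge0 ?subr_ge0// ltW.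
  lra.
have h4 := conv u m v au ltac:(rewrite /m; lra) ltac:(rewrite /m; lra) vb.
have d0 : 0 < (v - u) / 2 by lra.
have E1 : v - m = (v - u) / 2 by rewrite /m; lra.
have E2 : m - u = (v - u) / 2 by rewrite /m; lra.
have E3 : m - w = (v - u) / 4 by rewrite wE /m; lra.
have E4 : w - u = (v - u) / 4 by rewrite wE; lra.
rewrite E1 E2 ler_pM2r// in h4; rewrite E1 in h1; rewrite E3 in h2; rewrite E3 E4 in h3.
have : 0 < e * ((v - u) / 4) * ((v - u) / 4) by rewrite !mulr_gt0//; lra.
lra.
Qed.

End PolynomialShape.

Section DividedDifferences.
Context {R : realType}.
Implicit Types (a b x y w z : R) (p P : {poly R}) (f g : R -> R).

Let i0 : 'I_3 := ord0.
Let i1 : 'I_3 := lift ord0 ord0.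
Let i2 : 'I_3 := lift ord0 (lift ord0 ord0).

Lemma divided_difference1 f (t : 'I_2 -> R) :
  divided_difference f t = f (t ord0) / (t ord0 - t ord_max) +
                           f (t ord_max) / (t ord_max - t ord0).
Proof.
have -> : ord_max = lift ord0 ord0 :> 'I_2 by exact/val_inj.
rewrite /divided_difference !big_ord_recl big_ord0 addr0.
by rewrite !(big_mkcond (fun j => j != _)) !big_ord_recl !big_ord0 /= !mulr1 !mul1r.
Qed.

Lemma divided_difference2 f (t : 'I_3 -> R) :
  divided_difference f t =
    f (t i0) / ((t i0 - t i1) * (t i0 - t i2)) +
    f (t i1) / ((t i1 - t i0) * (t i1 - t i2)) +
    f (t i2) / ((t i2 - t i0) * (t i2 - t i1)).
Proof.
rewrite /divided_difference !big_ord_recl big_ord0 addr0 addrA.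
by rewrite !(big_mkcond (fun j => j != _)) !big_ord_recl !big_ord0 /= !mulr1 !mul1r.
Qed.

Lemma q_monotone1P f : q_monotone 1 f <->
  (forall x y, -1 <= x -> x < y -> y <= 1 -> f x <= f y).
Proof.
split=> [qf x y x1 xy y1|mono t tinj t1].
  pose t (i : 'I_2) := if i == ord0 then x else y.
  have := qf t; rewrite divided_difference1 /t /=.
  have -> : f x / (x - y) + f y / (y - x) = (f y - f x) / (y - x).
    by field; rewrite !subr_eq0 gt_eqF// lt_eqF.
  rewrite pmulr_lge0 ?invr_gt0 ?subr_gt0// subr_ge0; apply.
    move=> i j; rewrite /t; case: (unliftP ord0 i) => [i'|] ->; case: (unliftP ord0 j) => [j'|] -> //=.
    - by move=> _; rewrite (ord1 i') (ord1 j').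
    - by move=> E; move: xy; rewrite E ltxx.
    - by move=> E; move: xy; rewrite E ltxx.
  by move=> i; rewrite in_itv /=; case: ifP => _; lra.
rewrite divided_difference1.
have := t1 ord0; have := t1 ord_max; rewrite !in_itv /=.
have : t ord0 != t ord_max by apply: contra_neq (tinj _ _) _.
set x := t ord0; set y := t ord_max; rewrite neq_lt => xy hx hy.
have -> : f x / (x - y) + f y / (y - x) = (f y - f x) / (y - x).
  by field; rewrite !subr_eq0; case/orP: xy => h; rewrite ?(gt_eqF h) ?(lt_eqF h).
case/orP: xy => h.
  by rewrite divr_ge0 ?subr_ge0 ?(ltW h)// mono//; lra.
rewrite -mulrNN -invrN !opprB divr_ge0 ?subr_ge0 ?(ltW h)// mono//; lra.
Qed.

(** Its symmetry, through [dd3C] and [dd3AC], reduces the six orderings of three nodes to the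
    increasing one. *)
Let dd3 f x y w := f x / ((x - y) * (x - w)) + f y / ((y - x) * (y - w)) +
  f w / ((w - x) * (w - y)).

Let dd3C f x y w : dd3 f x y w = dd3 f y x w.
Proof. by rewrite /dd3 [X in X + _ = _]addrC [(w - x) * _]mulrC. Qed.

Let dd3AC f x y w : dd3 f x y w = dd3 f x w y.
Proof. by rewrite /dd3 addrAC [(x - y) * _]mulrC. Qed.

Let dd3_ge0 f x y w : x < y -> y < w ->
  (0 <= dd3 f x y w) = ((f y - f x) * (w - y) <= (f w - f y) * (y - x)).
Proof.
move=> xy yw; have xw := lt_trans xy yw.
have -> : dd3 f x y w = ((f w - f y) * (y - x) - (f y - f x) * (w - y)) /
    ((y - x) * (w - y) * (w - x)).
  by rewrite /dd3; field; rewrite !subr_eq0 !(gt_eqF xy, gt_eqF yw, gt_eqF xw, lt_eqF xy, lt_eqF yw, lt_eqF xw).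
by rewrite pmulr_lge0 ?subr_ge0// invr_gt0 !mulr_gt0// subr_gt0.
Qed.

Lemma q_monotone2P f : q_monotone 2 f <->
  (forall x y w, -1 <= x -> x < y -> y < w -> w <= 1 ->
    (f y - f x) * (w - y) <= (f w - f y) * (y - x)).
Proof.
split=> [qf x y w x1 xy yw w1|conv t tinj t1].
  have xw := lt_trans xy yw.
  pose t (i : 'I_3) := nth x [:: x; y; w] i.
  rewrite -dd3_ge0//; have := qf t; rewrite divided_difference2 => /(_ _ _)/le_trans; apply=> //.
    move=> i j /eqP; rewrite /t nth_uniq ?ltn_ord//; first by move/eqP/val_inj.
    by rewrite /= !inE !negb_or !(lt_eqF xy, lt_eqF yw, lt_eqF xw).
  move=> i; rewrite in_itv /= /t; case: i => -[|[|[|]]]//= _; lra.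
rewrite divided_difference2 -/(dd3 f (t i0) (t i1) (t i2)).
have n01 : t i0 != t i1 by apply: contra_neq (tinj _ _) _.
have n02 : t i0 != t i2 by apply: contra_neq (tinj _ _) _.
have n12 : t i1 != t i2 by apply: contra_neq (tinj _ _) _.
have := t1 i0; have := t1 i1; have := t1 i2; rewrite !in_itv /=.
move: (t i0) (t i1) (t i2) n01 n02 n12 => x y w.
have H a b c : -1 <= a <= 1 -> -1 <= b <= 1 -> -1 <= c <= 1 -> a < b -> b < c -> 0 <= dd3 f a b c.
  by move=> *; rewrite dd3_ge0// conv//; lra.
rewrite !neq_lt => /orP[] xy /orP[] xw /orP[] yw w1 y1 x1; try lra.
- exact: H.
- by rewrite dd3AC; exact: H.
- by rewrite dd3AC dd3C; exact: H.
- by rewrite dd3C; exact: H.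
- by rewrite dd3C dd3AC; exact: H.
- by rewrite dd3C dd3AC dd3C; exact: H.
Qed.

End DividedDifferences.

Section MonotoneJump.
Context {R : realType}.
Implicit Types (a b x y w z : R) (p P : {poly R}) (f g : R -> R).

Lemma cell_deriv_ge0 k f a b P : k = 1%N \/ k = 2%N -> q_monotone k f ->
  -1 <= a -> a < b -> b <= 1 -> (forall x, a < x < b -> f x = P.[x]) ->
  forall x, a <= x <= b -> 0 <= P^`(k).[x].
Proof.
move=> [] -> qf a1 ab b1 fP x xab.
  rewrite derivn1; apply: (poly_deriv_ge0 ab) xab => u v au uv vb.
  by rewrite -!fP ?au ?vb ?(lt_trans uv) ?(lt_trans au)//; move/q_monotone1P: qf; apply=> //; lra.
rewrite derivSn derivn1; apply: (poly_deriv2_ge0 ab) xab => u v w au uv vw wb.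
have -> : P.[u] = f u by rewrite fP//; lra.
have -> : P.[v] = f v by rewrite fP//; lra.
have -> : P.[w] = f w by rewrite fP//; lra.
by move/q_monotone2P: qf; apply=> //; lra.
Qed.

(** Inequalities between values of [f] become polynomial inequalities on an open interval and pass
    to its endpoints by closure. The bound at [z] is needed because the pieces do not determine the
    value of [f] at a knot. *)
Lemma monotone_jump k f a z b P1 P2 : k = 1%N \/ k = 2%N -> q_monotone k f ->
  -1 <= a -> a < z -> z < b -> b <= 1 ->
  (forall x, a < x < z -> f x = P1.[x]) -> (forall x, z < x < b -> f x = P2.[x]) ->
  jump_condition k (P2 - P1) z /\ `|f z - P1.[z]| <= `|(P2 - P1).[z]|.
Proof.
move=> hk qf a1 az zb b1 f1 f2.
have E12 : (P2 - P1).[z] = P2.[z] - P1.[z] by rewrite hornerD hornerN.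
have cl P (c d : R) u v : u < v -> (forall x, u < x < v -> 0 <= c + d * P.[x]) ->
    forall x, u <= x <= v -> 0 <= c + d * P.[x].
  move=> uv h x xuv; have E y : (c%:P + d *: P).[y] = c + d * P.[y].
    by rewrite hornerD hornerC hornerZ.
  by rewrite -E; apply: (poly_ge0_closure uv) xuv => y /h; rewrite E.
case: hk qf => -> qf; rewrite /jump_condition /= E12.
  move/q_monotone1P: qf => mono.
  have h1 : P1.[z] <= f z.
    suff : 0 <= f z + -1 * P1.[z] by lra.
    apply: (cl _ _ _ _ _ az); last by lra.
    by move=> x xaz; rewrite -f1//; have := mono x z ltac:(lra) ltac:(lra) ltac:(lra); lra.
  have h2 : f z <= P2.[z].
    suff : 0 <= - f z + 1 * P2.[z] by lra.
    apply: (cl _ _ _ _ _ zb); last by lra.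
    by move=> x xzb; rewrite -f2//; have := mono z x ltac:(lra) ltac:(lra) ltac:(lra); lra.
  by split; [lra|rewrite !ger0_norm; lra].
move/q_monotone2P: qf => conv.
have clq (q : {poly R}) u v : u < v -> (forall x, u < x < v -> 0 <= q.[x]) ->
    0 <= q.[u] /\ 0 <= q.[v].
  by move=> uv h; split; apply: (poly_ge0_closure uv h); rewrite lexx ltW.
pose xa := (a + z) / 2; pose wb := (z + b) / 2.
have [xa1 xa2] : a < xa /\ xa < z by rewrite /xa; lra.
have [wb1 wb2] : z < wb /\ wb < b by rewrite /wb; lra.
(* For y tending to [z] from the right, the chord from [z] to [wb] bounds [f] from above and the
   extended chord through [xa] and [z] bounds it from below. *)
have E2 : P2.[z] = f z.
  apply/eqP; rewrite eq_le; apply/andP; split.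
    pose q := (f wb)%:P * ('X - z%:P) - P2 * ('X - z%:P) - (P2 - (f z)%:P) * (wb%:P - 'X).
    have [|h _] := clq q z wb wb1.
      move=> y y1; rewrite !hornerE -f2; last by lra.
      by have := conv z y wb ltac:(lra) ltac:(lra) ltac:(lra) ltac:(lra); lra.
    move: h; rewrite !hornerE subrr !mulr0 subr0 sub0r oppr_ge0.
    by rewrite pmulr_lle0 ?subr_gt0// subr_le0.
  pose q := (P2 - (f z)%:P) * (z - xa)%:P - (f z - f xa)%:P * ('X - z%:P).
  have [|h _] := clq q z b zb.
    move=> y y1; rewrite !hornerE -f2; last by lra.
    by have := conv xa z y ltac:(lra) ltac:(lra) ltac:(lra) ltac:(lra); lra.
  move: h; rewrite !hornerE subrr mulr0 subr0.
  by rewrite pmulr_lge0 ?subr_gt0// subr_ge0.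
have E1 : P1.[z] = f z.
  apply/eqP; rewrite eq_le; apply/andP; split.
    pose q := ((f z)%:P - P1) * ('X - xa%:P) - (P1 - (f xa)%:P) * (z%:P - 'X).
    have [|_ h] := clq q xa z xa2.
      move=> y y1; rewrite !hornerE -f1; last by lra.
      by have := conv xa y z ltac:(lra) ltac:(lra) ltac:(lra) ltac:(lra); lra.
    move: h; rewrite !hornerE subrr mulr0 subr0.
    by rewrite pmulr_lge0 ?subr_gt0// subr_ge0.
  pose q := (f wb - f z)%:P * (z%:P - 'X) - ((f z)%:P - P1) * (wb - z)%:P.
  have [|_ h] := clq q a z az.
    move=> y y1; rewrite !hornerE -f1; last by lra.
    by have := conv y z wb ltac:(lra) ltac:(lra) ltac:(lra) ltac:(lra); lra.
  move: h; rewrite !hornerE subrr mulr0 sub0r oppr_ge0.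
  by rewrite pmulr_lle0 ?subr_gt0// subr_le0.
split; last by rewrite E1 E2 !subrr.
split; first by rewrite E1 E2 subrr.
(* The symmetric second difference of [f] at [z]: nonnegative for small t > 0, zero at 0, and its
   derivative at 0 is that of [P2 - P1] at [z]. *)
pose q := (P2 \Po affine z 1) + (P1 \Po affine z (-1)) - (2 * f z)%:P.
pose d := Num.min (z - a) (b - z).
have d0 : 0 < d by rewrite lt_min !subr_gt0 az.
have [d1 d2] : d <= z - a /\ d <= b - z by rewrite /d !ge_min !lexx orbT.
have qE t : q.[t] = P2.[z + t] + P1.[z - t] - 2 * f z.
  by rewrite hornerD hornerN hornerD !horner_comp !horner_affine hornerC mul1r mulN1r.
have dq : q^`().[0] = (P2 - P1)^`().[z].
  rewrite /q !derivD !derivN derivC subr0 !deriv_comp !deriv_affine hornerD.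
  by rewrite !hornerM !horner_comp !horner_affine !hornerC !mulr0 !addr0 mulr1 mulrN1 hornerD hornerN.
rewrite -dq; apply: (@poly_ge0_deriv0 _ q d d0); last first.
  by rewrite qE addr0 subr0 E1 E2; lra.
move=> t t0; rewrite qE -f2; last by lra.
rewrite -f1; last by lra.
have := conv (z - t) z (z + t) ltac:(lra) ltac:(lra) ltac:(lra) ltac:(lra).
rewrite (_ : z + t - z = t); last by ring.
rewrite (_ : z - (z - t) = t); last by ring.
by rewrite ler_pM2r; lra.
Qed.

End MonotoneJump.

(** * Partitions and remeshes *)

Section Knots.
Context {R : realType}.
Implicit Types (x c h eps delta : R) (z zt : seq R).

Lemma knot0 z : knot z 0 = -1. Proof. by []. Qed.

Lemma knot_size z : is_partition z -> knot z (size z) = 1.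
Proof.
move=> [_ /eqP E]; rewrite -[RHS]E /knot (last_nth 1); exact.
Qed.

Lemma knot_lt z i j : is_partition z -> (i < j)%N -> (j <= size z)%N ->
  knot z i < knot z j.
Proof.
move=> [pz _] ij jz; have sz : sorted <%R (-1 :: z) by [].
apply: (sorted_ltn_nth lt_trans 1 sz) => //; rewrite inE /= ltnS//.
exact: leq_trans (ltnW ij) jz.
Qed.

Lemma knot_le z i j : is_partition z -> (i <= j)%N -> (j <= size z)%N ->
  knot z i <= knot z j.
Proof.
move=> pz; rewrite leq_eqVlt => /orP[/eqP -> //|ij jz].
exact/ltW/knot_lt.
Qed.

Lemma knot_itv z i : is_partition z -> (i <= size z)%N -> -1 <= knot z i <= 1.
Proof. by move=> pz iz; rewrite -(knot0 z) -(knot_size pz) !knot_le. Qed.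

Lemma size_partition z : is_partition z -> (0 < size z)%N.
Proof. by case: z => [|a z]// [_ /= /eqP]; lra. Qed.

Lemma knot_locate z c : is_partition z -> -1 <= c < 1 ->
  exists2 i, (i < size z)%N & knot z i <= c < knot z i.+1.
Proof.
move=> pz /andP[c1 c2].
have ex : exists i, c < knot z i by exists (size z); rewrite knot_size.
case: (ex_minnP ex) => -[|i]; first by rewrite knot0; lra.
move=> ci min; exists i.
  have := min (size z); rewrite knot_size//; exact.
by rewrite ci andbT leNgt; apply/negP => /min; rewrite ltnn.
Qed.

Definition cell_mid z i : R := (knot z i + knot z i.+1) / 2.

Lemma cell_mid_itv z i : is_partition z -> (i < size z)%N ->
  knot z i < cell_mid z i < knot z i.+1.
Proof. by move=> pz iz; have := knot_lt pz (ltnSn i) iz; rewrite /cell_mid; lra. Qed.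

Definition lower_end z j : R := if j is i.+1 then cell_mid z i else -1.
Definition upper_end z j : R := if (j < size z)%N then cell_mid z j else 1.

Lemma IsetE z j : is_partition z -> (j <= size z)%N ->
  Iset z j = `[lower_end z j, upper_end z j]%classic.
Proof.
move=> pz jz.
have El : (cknot z (j%:Z - 1) + cknot z j%:Z) / 2 = lower_end z j.
  case: j {jz} => [|j]; first by rewrite /= knot0; lra.
  by have -> : j.+1%:Z - 1 = j%:Z by rewrite intS addrAC subrr add0r.
have Eu : (cknot z j%:Z + cknot z (j%:Z + 1)) / 2 = upper_end z j.
  have -> : j%:Z + 1 = j.+1%:Z by rewrite intS addrC.
  rewrite /= /upper_end; have [//|zj] := ltnP j (size z).
  have -> : j = size z by apply/eqP; rewrite eqn_leq jz zj.
  by rewrite knot_size// /knot /= nth_default//; lra.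
by rewrite /Iset El Eu.
Qed.

Lemma Iset_cover z x : is_partition z -> -1 <= x <= 1 ->
  exists2 j, (j <= size z)%N & lower_end z j <= x <= upper_end z j.
Proof.
move=> pz /andP[x1 x2].
have ex : exists j, x <= upper_end z j.
  by exists (size z); rewrite /upper_end ltnn.
case: (ex_minnP ex) => j xj min; have jz : (j <= size z)%N.
  by apply: min; rewrite /upper_end ltnn.
exists j => //; rewrite xj andbT.
case: j jz xj min => [|j] jz xj min //=.
have := min j; rewrite ltnn /upper_end jz => h.
by rewrite leNgt; apply/negP => /ltW /h.
Qed.

Lemma Iset_lt z j : is_partition z -> (j <= size z)%N ->
  lower_end z j < upper_end z j.
Proof.
move=> pz jz; have sz0 := size_partition pz.
rewrite /upper_end; case: ltnP => jz'.
  case: j jz jz' => [|j] jz jz' /=.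
    by have := cell_mid_itv pz jz'; rewrite knot0; lra.
  by have := cell_mid_itv pz jz; have := cell_mid_itv pz jz'; lra.
have Ej : j = size z by apply/eqP; rewrite eqn_leq jz.
rewrite Ej -[size z]prednK//=.
have := @cell_mid_itv z (size z).-1 pz; rewrite prednK// => /(_ (leqnn _)).
by rewrite knot_size//; lra.
Qed.

Lemma egap_fin z i : is_partition z -> (i < size z)%N ->
  egap z i%:Z = (knot z i.+1 - knot z i)%:E.
Proof.
move=> pz iz; rewrite /egap -PoszD addn1 /= iz ltnW//.
by rewrite -EFinD abse_EFin ger0_norm// subr_ge0 knot_le.
Qed.

(** The remesh cell containing [c] is so short that its right end falls into the window. Whichever
    side of the knot [c] is on, the minimum over neighbouring cells involves both gaps adjacent to
    the knot, so it suffices to compare with either of them. *)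
Lemma remesh_dense delta z zt k eps h : is_partition z -> is_remesh delta z zt ->
  0 < delta -> (k.+1 < size z)%N -> 0 < h ->
  h < knot z k.+1 - knot z k -> h < knot z k.+2 - knot z k.+1 ->
  (delta * (knot z k.+1 - knot z k) <= eps * h \/
   delta * (knot z k.+2 - knot z k.+1) <= eps * h) ->
  dense (-1 :: zt) (eps * h) (knot z k.+1 - h) (knot z k.+1 + h).
Proof.
move=> pz [pzt rem] delta0 kz h0 hl hr hd c c1 c2.
have kz' := ltnW kz.
have K01 := knot_lt pz (ltnSn k) kz'; have K12 := knot_lt pz (ltnSn k.+1) kz.
have /andP[k01 _] := knot_itv pz (ltnW kz'); have /andP[_ k12] := knot_itv pz kz.
have eh : 0 < eps * h.
  by case: hd => /(lt_le_trans _); apply; rewrite mulr_gt0// subr_gt0.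
have [|i iz /andP[ci1 ci2]] := knot_locate pzt (_ : -1 <= c < 1); first by lra.
have fin : ((knot zt i.+1 - knot zt i)%:E <= delta%:E * mine (egap z k%:Z) (egap z k.+1%:Z))%E ->
    knot zt i.+1 - knot zt i <= eps * h.
  rewrite !egap_fin// -EFin_min -EFinM lee_fin => h1; apply: (le_trans h1).
  case: hd; apply: le_trans; rewrite ler_wpM2l ?(ltW delta0)// ge_min lexx ?orbT//.
have sub : knot zt i.+1 - knot zt i <= eps * h.
  apply: fin; have d0 : (0 <= delta%:E)%E by rewrite lee_fin ltW.
  have [cz|zc] := ltP c (knot z k.+1).
    apply: (le_trans (rem k kz' i iz _)).
      by exists c; rewrite /= !in_itv /=; lra.
    rewrite lee_wpmul2l// -[k%:Z + 1]/(Posz (k + 1)) addn1.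
    by rewrite ge_min lexx orbT.
  (* [c] may be the knot itself, which the open cell excludes; the midpoint of [c] and [y] lies in
     both cells. *)
  pose y := Num.min (knot zt i.+1) (knot z k.+2).
  have y1 : c < y by rewrite lt_min ci2; lra.
  have [y2 y3] : y <= knot zt i.+1 /\ y <= knot z k.+2 by rewrite !ge_min !lexx orbT.
  apply: (le_trans (rem k.+1 kz i iz _)).
    by exists ((c + y) / 2); rewrite /= !in_itv /=; lra.
  rewrite lee_wpmul2l// (_ : k.+1%:Z - 1 = k%:Z); last first.
    by rewrite intS addrAC subrr add0r.
  by rewrite minA ge_min lexx.
exists (knot zt i.+1); last by lra.
by apply: mem_nth; rewrite /= ltnS.
Qed.

End Knots.

(** * Assembling the local constructions *)

Section SplineSpace.
Context {R : realType}.
Implicit Types (x y t : R) (P : {poly R}) (L : seq (R * R)) (f g : R -> R) (z : seq R).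

Lemma is_derive_within (D : set R) f g :
  (forall x : R, is_derive x 1 f (g x)) -> is_derivative_within D f g.
Proof.
move=> df x _; have [der Ed] := df x.
have H : (fun h => h^-1 *: ((f \o shift x) (h *: 1) - f x)) @ 0^' --> g x.
  by rewrite -Ed; exact: der.
apply/cvgrPdist_lt => e e0; move/cvgrPdist_lt : H => /(_ e e0).
rewrite !near_withinE => /nbhs_ballP[d /= d0 hd].
apply/nbhs_ballP; exists d => //= y xy yx _.
have := hd (y - x); rewrite -!ball_normE /= sub0r normrN distrC in xy *; move=> /(_ xy).
rewrite subr_eq0 => /(_ yx); rewrite /GRing.scale /= mulr1 subrK [_^-1 * _]mulrC; exact.
Qed.

Lemma continuous_tspline1 L : continuous (tspline 1 L).
Proof.
elim: L => [|u L IHL] x.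
  rewrite (_ : tspline 1 [::] = cst 0); first exact: cvg_cst.
  by apply/funext => y; rewrite /tspline big_nil.
rewrite (_ : tspline 1 (u :: L) =
  (fun y => u.1 * (((y - u.2) + `|y - u.2|) / 2) + tspline 1 L y)).
  apply: cvgD; last exact: IHL.
  apply: cvgMr; apply: cvgMl; apply: cvgD; last apply: cvg_norm;
    by apply: cvgB; [exact: cvg_id|exact: cvg_cst].
apply/funext => y; rewrite /tspline big_cons; congr (_ * _ + _).
rewrite /tpower expr1 divr1; have [h|h] := leP u.2 y.
  by rewrite ger0_norm ?subr_ge0//; lra.
by rewrite ltr0_norm ?subr_lt0//; lra.
Qed.

Lemma is_derive_pspline n P L x :
  is_derive x 1 (fun y => P.[y] + tspline n.+2 L y) (P^`().[x] + tspline n.+1 L x).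
Proof.
rewrite (_ : (fun y => _) = (horner P : R -> R) + (tspline n.+2 L : R -> R)) //.
apply: is_deriveD; exact: is_derive_tspline.
Qed.

Lemma is_Ck_pspline (D : set R) k n P L : (k <= n)%N ->
  is_Ck k D (fun y => P.[y] + tspline n.+1 L y).
Proof.
elim: k n P => [|k IHk] n P kn.
  apply: continuous_subspaceT => x.
  apply: cvgD; first exact: continuous_horner.
  case: n kn => [|n] _; first exact: continuous_tspline1.
  apply/differentiable_continuous/derivable1_diffP.
  exact: (ex_derive (is_derive := is_derive_tspline n L x)).
case: n kn => [//|n] kn.
exists (fun y => P^`().[y] + tspline n.+1 L y); last exact: IHk.
by apply: is_derive_within => x; exact: is_derive_pspline.
Qed.

(** Knots of [L] are knots of [zt], so none falls inside a cell, and there each truncated power is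
    either its polynomial or 0. *)
Lemma ppf_pspline n P L zt : is_partition zt -> (size P <= n.+2)%N ->
  (forall u, u \in L -> u.2 \in -1 :: zt) ->
  ppf n.+1 zt (fun y => P.[y] + tspline n.+1 L y).
Proof.
move=> pz sP hL i iz; exists (P + tpoly n.+1 [seq u <- L | u.2 <= knot zt i]).
  by rewrite (leq_trans (size_polyD _ _))// geq_max sP size_tpoly.
move=> x; rewrite in_itv /= => /andP[x1 x2]; rewrite hornerD; congr (_ + _).
rewrite /tspline /tpoly horner_sum big_filter [RHS]big_mkcond /= big_seq [RHS]big_seq.
apply: eq_bigr => u uL; rewrite /tpower; case: (leP u.2 (knot zt i)) => h.
  rewrite ifT; last exact: le_trans h (ltW x1).
  by rewrite hornerZ horner_exp hornerXsubC mulrAC mulrA.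
rewrite ifF ?mulr0//; apply: negbTE; rewrite -ltNge; apply: contraTT h; rewrite -!leNgt => ux.
have /(nthP 1)[l] := hL u uL; rewrite -[nth _ _ _]/(knot zt l) /= ltnS => lz El.
rewrite -El; apply: knot_le => //; last exact: ltnW.
rewrite leqNgt; apply/negP => il; move: x2; rewrite ltNge => /negP; apply.
by apply: le_trans ux; rewrite -El knot_le.
Qed.

Lemma q_monotone_pspline k n P L : k = 1%N \/ k = 2%N ->
  (forall x, -1 <= x <= 1 -> 0 <= P^`(k).[x] + tspline n.+1 L x) ->
  q_monotone k (fun y => P.[y] + tspline (k + n.+1) L y).
Proof.
move=> [] -> h.
  apply/q_monotone1P => x y x1 xy y1.
  apply: (derive_ge0_le (is_derive_pspline n P L)); first exact: ltW.
  by move=> u /andP[u1 u2]; rewrite -derivn1; apply: h; lra.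
apply/q_monotone2P => x y w x1 xy yw w1.
pose f y := P.[y] + tspline (2 + n.+1) L y.
pose g y := P^`().[y] + tspline n.+2 L y.
have df (u : R) : is_derive u 1 f (g u) by exact: is_derive_pspline.
have dg (u : R) : is_derive u 1 g (P^`()^`().[u] + tspline n.+1 L u) by exact: is_derive_pspline.
have mono u v : -1 <= u -> u <= v -> v <= 1 -> g u <= g v.
  move=> u1 uv v1; apply: (derive_ge0_le dg uv) => t /andP[t1 t2].
  have := h t; rewrite derivSn derivn1; apply; lra.
have dl (c u : R) : is_derive u 1 (horner (c *: 'X)) c.
  by have := is_derive_poly (c *: 'X) u; rewrite derivZ derivX hornerZ hornerC mulr1.
have h1 : f y - f x <= g y * (y - x).
  have := derive_le_sub df (dl (g y)) (ltW xy); rewrite !hornerZ !hornerX -mulrBr; apply.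
  by move=> t /andP[t1 t2]; apply: mono; lra.
have h2 : g y * (w - y) <= f w - f y.
  have := derive_le_sub (dl (g y)) df (ltW yw); rewrite !hornerZ !hornerX -mulrBr; apply.
  by move=> t /andP[t1 t2]; apply: mono; lra.
rewrite -[X in X * _ <= _]/(f y - f x) -[X in _ <= X * _]/(f w - f y).
apply: (@le_trans _ _ (g y * (y - x) * (w - y))).
  by rewrite ler_pM2r// subr_gt0.
by rewrite mulrAC ler_pM2r// subr_gt0.
Qed.

End SplineSpace.

Section Glue.
Context {R : realType}.
Implicit Types (x h e : R) (P Q : {poly R}) (L : seq (R * R)) (z zt K : seq R).

Lemma derivn_tpoly k n L : (tpoly (k + n) L)^`(k) = tpoly n L.
Proof.
elim: k n => [|k IHk] n; first by rewrite derivn0.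
by rewrite derivSn addSn deriv_tpoly IHk.
Qed.

Definition gather (LL : nat -> seq (R * R)) N : seq (R * R) :=
  flatten [seq LL i | i <- iota 0 N].

Lemma gather_recr (LL : nat -> seq (R * R)) N : gather LL N.+1 = gather LL N ++ LL N.
Proof. by rewrite /gather -addn1 iotaD map_cat flatten_cat /= cats0. Qed.

(** Corrections of index below [i] have been passed and telescope from [E 0] to [E i]; those of
    index above [i] have not begun. [E] is general because the pieces and their k-th derivatives are
    both needed. *)
Lemma tspline_gather m K (e h : nat -> R) (E : nat -> {poly R})
    (LL : nat -> seq (R * R)) N i x :
  (0 < m)%N ->
  (forall j, (j < N)%N -> knots_in K (e j - h j) (e j + h j) (LL j)) ->
  (forall j, (j < N)%N -> tpoly m (LL j) = E j.+1 - E j) -> (i <= N)%N ->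
  (forall j, (j < i)%N -> e j + h j <= x) ->
  (forall j, (i < j < N)%N -> x <= e j - h j) ->
  (E 0%N).[x] + tspline m (gather LL N) x =
  (E i).[x] + (if (i < N)%N then tspline m (LL i) x else 0).
Proof.
move=> m0; elim: N i => [|N IHN] i kL pL iN hi lo.
  by move: iN; rewrite leqn0 => /eqP ->; rewrite /tspline big_nil.
have kL' j : (j < N)%N -> knots_in K (e j - h j) (e j + h j) (LL j).
  by move=> jN; apply: kL; exact: ltnW.
have pL' j : (j < N)%N -> tpoly m (LL j) = E j.+1 - E j.
  by move=> jN; apply: pL; exact: ltnW.
rewrite gather_recr tspline_cat addrA.
have [iN'|Ni] := leqP i N; last first.
  have Ei : i = N.+1 by apply/eqP; rewrite eqn_leq iN Ni.
  rewrite Ei in hi lo *; rewrite ltnn addr0.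
  rewrite (IHN N kL' pL' (leqnn N)) ?ltnn ?addr0.
  - rewrite (tspline_right _ (kL N (ltnSn N))) ?hi// pL// hornerD hornerN addrC subrK//.
  - by move=> j jN; apply: hi; exact: ltnW.
  - by move=> j /andP[h1 h2]; have := ltn_trans h1 h2; rewrite ltnn.
rewrite (IHN i kL' pL' iN' hi); last first.
  by move=> j /andP[ij jN]; apply: lo; rewrite ij ltnW.
rewrite ltnS iN' -addrA; congr (_ + _).
have [iN''|Ni] := ltnP i N.
  by rewrite (tspline_left m0 (kL N (ltnSn N))) ?addr0// lo// iN'' ltnSn.
by have -> : i = N by [apply/eqP; rewrite eqn_leq iN' Ni]; rewrite add0r.
Qed.

Lemma cell_mid_le z i j : is_partition z -> (i <= j)%N -> (j < size z)%N ->
  cell_mid z i <= cell_mid z j.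
Proof.
move=> pz ij jz.
have := knot_le pz ij (ltnW jz); have := knot_le pz (ij : (i < j.+1)%N) jz.
by rewrite /cell_mid; lra.
Qed.

Lemma modulusJ_ge0 m (f : R -> R) (a b : R) p : a < b -> (0 <= modulusJ m f `[a, b] p)%E.
Proof.
move=> ab; apply: (@le_trans _ _ (Lpnorm p `[a, b] (Delta m (b - a) f `[a, b]))).
  exact: Lnorm_ge0.
apply: ereal_sup_ubound; exists (b - a) => //=.
by rewrite lebesgue_measure_itv/= lte_fin ab /= subr_gt0 ab lexx.
Qed.

Lemma indic_norm_gt0 (p : \bar R) (M l : R) : 0 < M -> 0 < l -> 0 < indic_norm p M l.
Proof. by move=> M0 l0; rewrite /indic_norm; case: p => // r; rewrite mulr_gt0// powR_gt0. Qed.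

Definition blend k n K P Q e h C L : Prop :=
  [/\ knots_in K (e - h) (e + h) L, tpoly (k + n.+1) L = Q - P,
    forall x, e - h <= x <= e + h -> 0 <= P^`(k).[x] + tspline n.+1 L x &
    forall x, e - h <= x <= e + h -> `|tspline (k + n.+1) L x| <= C].

(** [M] steps of this size on either side of the knot stay between the midpoints of the adjacent
    cells, hence in the set [Iset] of that knot: the room needed by a difference of order [M]. *)
Definition half_width (M : R) z i : R :=
  Num.min (knot z i.+1 - knot z i) (knot z i.+2 - knot z i.+1) / (2 * M).

Lemma half_width_gt0 M z i : is_partition z -> (i.+1 < size z)%N -> 1 <= M ->
  0 < half_width M z i.
Proof.
move=> pz iz M1; rewrite divr_gt0 ?mulr_gt0//; last by lra.
by rewrite lt_min !subr_gt0 !knot_lt// ltnW.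
Qed.

Lemma half_width_le M z i : is_partition z -> (i.+1 < size z)%N -> 1 <= M ->
  cell_mid z i <= knot z i.+1 - M * half_width M z i /\
  knot z i.+1 + M * half_width M z i <= cell_mid z i.+1.
Proof.
move=> pz iz M1; have -> : M * half_width M z i =
    Num.min (knot z i.+1 - knot z i) (knot z i.+2 - knot z i.+1) / 2.
  by rewrite /half_width; field; rewrite gt_eqF//; lra.
set d := Num.min _ _.
have [d1 d2] : d <= knot z i.+1 - knot z i /\ d <= knot z i.+2 - knot z i.+1.
  by rewrite /d !ge_min !lexx orbT.
by rewrite /cell_mid; lra.
Qed.

End Glue.

Section Assembly.
Context {R : realType}.
Implicit Types (x h e M B C : R) (P Q : {poly R}) (L : seq (R * R)) (z zt K : seq R).

Lemma ltn_pred_size z i : (i < (size z).-1)%N = (i.+1 < size z)%N.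
Proof. by rewrite -ltnS; case: (size z) => [|m]//=; rewrite ltnS. Qed.

(** The correction at knot j has index [j.-1]. For j = 0 the index 0 is reused, which is harmless as
    that correction begins after the first midpoint; at the last knot no correction is left. *)
Lemma tspline_gather_Iset m K M z (E : nat -> {poly R}) (LL : nat -> seq (R * R)) j x :
  is_partition z -> 1 <= M -> (0 < m)%N ->
  (forall i, (i.+1 < size z)%N -> knots_in K (knot z i.+1 - half_width M z i)
     (knot z i.+1 + half_width M z i) (LL i)) ->
  (forall i, (i.+1 < size z)%N -> tpoly m (LL i) = E i.+1 - E i) ->
  (j <= size z)%N -> lower_end z j <= x <= upper_end z j ->
  (E 0%N).[x] + tspline m (gather LL (size z).-1) x =
  (E j.-1).[x] + (if (j.-1.+1 < size z)%N then tspline m (LL j.-1) x else 0).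
Proof.
move=> pz M1 m0 kL pL jz /andP[x1 x2]; rewrite -ltn_pred_size.
have hw i : (i.+1 < size z)%N -> half_width M z i <= M * half_width M z i.
  by move=> iz; rewrite ler_peMl// ltW// half_width_gt0.
apply: (tspline_gather (e := fun i => knot z i.+1) (h := half_width M z) m0).
- by move=> i; rewrite ltn_pred_size; exact: kL.
- by move=> i; rewrite ltn_pred_size; exact: pL.
- by rewrite -!subn1 leq_sub2r.
- case: j jz x1 {x2} => [|j] jz //= x1 i ij.
  have iz : (i.+1 < size z)%N by exact: leq_ltn_trans ij jz.
  have [_ h2] := half_width_le pz iz M1; have := hw i iz.
  by have := cell_mid_le pz ij jz; lra.
- move=> i /andP[ji]; rewrite ltn_pred_size => iz.
  have ji' : (j <= i)%N by case: j ji {jz x1 x2}.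
  have iz' := ltnW iz.
  rewrite /upper_end (leq_ltn_trans ji' iz') in x2.
  have [h1 _] := half_width_le pz iz M1; have := hw i iz.
  by have := cell_mid_le pz ji' iz'; lra.
Qed.

Lemma Iset_in_cells z j x : is_partition z -> (j <= size z)%N ->
  lower_end z j <= x <= upper_end z j ->
  knot z j.-1 <= x /\ x <= knot z j.+1.
Proof.
move=> pz jz /andP[x1 x2]; split.
  case: j jz x1 {x2} => [|j] jz /= x1; first by rewrite knot0.
  by have := cell_mid_itv pz jz; lra.
move: x2; rewrite /upper_end; case: ltnP => jz'.
  by have := cell_mid_itv pz jz'; lra.
have -> : j = size z by apply/eqP; rewrite eqn_leq jz.
by rewrite /knot /= nth_default.
Qed.

Lemma gather_ge0 k n K M z (P : nat -> {poly R}) (LL : nat -> seq (R * R)) x :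
  is_partition z -> 1 <= M ->
  (forall i, (i.+1 < size z)%N -> exists C, blend k n K (P i) (P i.+1) (knot z i.+1)
     (half_width M z i) C (LL i)) ->
  (forall i y, (i < size z)%N -> knot z i <= y <= knot z i.+1 -> 0 <= (P i)^`(k).[y]) ->
  -1 <= x <= 1 ->
  0 <= (P 0%N)^`(k).[x] + tspline n.+1 (gather LL (size z).-1) x.
Proof.
move=> pz M1 bl P0 x1; have [j jz xj] := Iset_cover pz x1.
have [x2 x3] := Iset_in_cells pz jz xj.
have pL i : (i.+1 < size z)%N -> tpoly n.+1 (LL i) = (P i.+1)^`(k) - (P i)^`(k).
  by move=> /bl[D [_ pD _ _]]; rewrite -derivnB -pD derivn_tpoly.
rewrite (tspline_gather_Iset (K := K) (M := M) (E := fun i => (P i)^`(k)) pz M1 (ltn0Sn n) _ pL jz xj); last first.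
  by move=> i /bl[D []].
have size0 := size_partition pz.
case: ltnP => [iz|zi]; last first.
  rewrite addr0; have ez : size z = j.-1.+1.
    by apply/eqP; rewrite eqn_leq zi /=; case: j jz {xj x2 x3 zi} => //=.
  apply: P0; first by rewrite ez.
  by rewrite x2 -ez knot_size//; case/andP: x1.
have [D [kD pD sD _]] := bl _ iz.
set e := knot z j.-1.+1 in kD sD *; set h := half_width M z j.-1 in kD sD *.
have h0 : 0 < h by exact: half_width_gt0.
have [xl|xl] := ltP x (e - h).
  rewrite (tspline_left _ kD) ?(ltW xl)// addr0; apply: P0; first exact: ltnW.
  by rewrite x2 -/e; lra.
have [xr|xr] := ltP (e + h) x.
  rewrite (tspline_right _ kD) ?(ltW xr)// pL// hornerD hornerN addrC subrK.
  apply: P0 => //; rewrite -/e; apply/andP; split; first by lra.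
  case: j jz xj x2 x3 iz @e @h kD pD sD h0 xl xr => [|j] //= jz xj x2 x3 iz *.
  by apply: (le_trans x3); exact: knot_le.
by apply: sD; rewrite xl.
Qed.

End Assembly.

(** * Error estimates on the intervals [Iset z j] *)

Section Approximation.
Context {R : realType}.
Implicit Types (x h e M B C : R) (P Q : {poly R}) (L : seq (R * R)) (z zt K : seq R).
Notation mu := (@lebesgue_measure R).

Lemma interior_error (p : \bar R) (f st : R -> R) (J : set R) e h W :
  (0 < p)%E -> 0 < h -> 0 <= W ->
  (forall x, J x -> x < e - h \/ e + h < x -> f x = st x) ->
  (forall x, J x -> e - h <= x <= e + h -> `|f x - st x| <= W) ->
  (Lpnorm p J (f \- st)%R <= (indic_norm p W (2 * h))%:E)%E.
Proof.
move=> p0 h0 W0 hout hin; pose A : set R := `[e - h, e + h]%classic.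
have mA : measurable A by exact: measurable_itv.
have muA : mu A = (2 * h)%:E.
  by rewrite lebesgue_measure_itv/= lte_fin ifT -?EFinD; [congr EFin; ring|lra].
have h20 : 0 <= 2 * h by lra.
apply: (le_trans _ (Lnorm_step_le p0 mA muA W0 h20)).
apply: le_Lnorm => // x; rewrite patchE /step_fun /= [X in (_ <= X%:E)%E]ger0_norm ?mulr_ge0//.
case: ifPn => [|_]; last by rewrite abse0 lee_fin mulr_ge0.
rewrite inE => Jx; rewrite /= lee_fin indicE.
have [xA|xA] := boolP (x \in A).
  by rewrite mulr1 hin//; move: xA; rewrite inE /A /= in_itv.
rewrite hout ?subrr ?normr0 ?mulr0//.
move: xA; rewrite notin_setE /A /= in_itv /= => /negP.
by rewrite negb_and -!ltNge => /orP.
Qed.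

(** On the two end intervals [s] is a single polynomial except possibly at -1 or 1. Its modulus
    gives nothing to spend there, so the error must vanish, up to that one point. *)
Lemma boundary_error (p : \bar R) (f st : R -> R) (J : set R) e :
  (0 < p)%E -> (forall x, J x -> x != e -> f x = st x) ->
  (Lpnorm p J (f \- st)%R <= 0)%E.
Proof.
move=> p0 H; apply: (@Lnorm_ae0 _ _ _ e) => //.
  move=> x xe; rewrite patchE; case: ifPn => //; rewrite inE => Jx /=.
  by rewrite H// subrr.
by move=> x; rewrite patchE; case: ifPn.
Qed.

Lemma jump_bound m P e h x B : 0 < h -> (size (P \Po affine e h) <= m)%N ->
  coef_bound (P \Po affine e h) B -> e <= x <= e + h -> `|P.[x]| <= m%:R * B.
Proof.
move=> h0 sP PB xe.
have -> : P.[x] = (P \Po affine e h).[(x - e) / h].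
  by rewrite horner_comp horner_affine; congr (_.[_]); field; rewrite gt_eqF.
apply: horner_bound => //.
by rewrite ger0_norm ?divr_ge0 ?ler_pdivrMr//; lra.
Qed.

Lemma spline_approx k n : k = 1%N \/ k = 2%N ->
  exists2 delta : R, 0 < delta &
  exists2 c : \bar R -> R, (forall p : \bar R, (0 < p)%E -> 0 < c p) &
  forall z, is_partition z ->
  forall s : R -> R, ppf (k + n.+1) z s -> q_monotone k s ->
  forall zt, is_remesh delta z zt ->
  exists st : R -> R,
    [/\ spline (k + n.+1) zt st, q_monotone k st &
        forall (p : \bar R) (j : nat), (0 < p)%E -> (j <= size z)%N ->
          (Lpnorm p (Iset z j) (s \- st)%R <=
             (c p)%:E * modulusJ (k + n.+1).+1 s (Iset z j) p)%E].
Proof.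
move=> hk; pose m := (k + n.+1)%N.
have [eps [C [eps0 C0 hloc]]] := @local_blending R n.
have [c0 [l [c00 l0 hmod]]] := @modulus_ge_jump R m.
pose M : R := m.+1%:R; have M1 : 1 <= M by rewrite ler1n.
have M0 : 0 < M by lra.
(* So that delta times the smaller gap equals [eps] times the half width. *)
exists (eps / (2 * M)); first by rewrite divr_gt0// mulr_gt0.
(* Ratio of the error bound (C + M) B on length 2 h to the lower bound c0 B on length h l for the
   difference. *)
exists (fun p => (C + M) / c0 * indic_norm p 1 (2 / l)).
  by move=> p _; rewrite mulr_gt0 ?indic_norm_gt0 ?divr_gt0// addr_gt0.
move=> z pz s ppfs qs zt rem; have [pzt _] := rem.
have : forall i, exists Q, (i < size z)%N -> (size Q <= m.+1)%N /\
    {in `]knot z i, knot z i.+1[, forall x, s x = Q.[x]}.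
  move=> i; have [iz|] := boolP (i < size z)%N; last by exists 0.
  by have [Q sQ EQ] := ppfs i iz; exists Q.
move=> /choice[P hP].
have sP i : (i < size z)%N -> (size (P i) <= m.+1)%N by case/hP.
have EP i x : (i < size z)%N -> knot z i < x < knot z i.+1 -> s x = (P i).[x].
  by move=> iz xi; case: (hP i iz) => _; apply; rewrite in_itv.
have P0 i y : (i < size z)%N -> knot z i <= y <= knot z i.+1 -> 0 <= (P i)^`(k).[y].
  move=> iz; apply: (cell_deriv_ge0 hk qs).
  - by case/andP: (knot_itv pz (ltnW iz)).
  - exact: knot_lt.
  - by case/andP: (knot_itv pz iz).
  - by move=> x; exact: EP.
have jump i : (i.+1 < size z)%N -> jump_condition k (P i.+1 - P i) (knot z i.+1) /\
    `|s (knot z i.+1) - (P i).[knot z i.+1]| <= `|(P i.+1 - P i).[knot z i.+1]|.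
  move=> iz; have iz' := ltnW iz; apply: (monotone_jump hk qs).
  - by case/andP: (knot_itv pz (ltnW iz')) => h _; exact: h.
  - exact: knot_lt.
  - exact: (knot_lt pz (ltnSn _)).
  - by case/andP: (knot_itv pz iz).
  - by move=> x; exact: EP.
  - by move=> x; exact: EP.
pose h i := half_width M z i.
pose D i := (P i.+1 - P i) \Po affine (knot z i.+1) (h i).
have /choice[kap hkap] : forall i, exists a, coef_bound (D i) `|(D i)`_a|.
  by move=> i; exact: max_coef.
pose B i := `|(D i)`_(kap i)|.
have B0 i : 0 <= B i by exact: normr_ge0.
have hw0 i : (i.+1 < size z)%N -> 0 < h i by move=> iz; exact: half_width_gt0.
have hw i : (i.+1 < size z)%N -> h i <= M * h i.
  by move=> iz; rewrite ler_peMl// ltW// hw0.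
have : forall i, exists L, (i.+1 < size z)%N ->
    blend k n (-1 :: zt) (P i) (P i.+1) (knot z i.+1) (h i) (C * B i) L.
  move=> i; have [iz|] := boolP (i.+1 < size z)%N; last by exists [::].
  have iz' := ltnW iz.
  have [h1 h2] := half_width_le pz iz M1; rewrite -/(h i) in h1 h2.
  have hi := hw0 i iz; have hi' := hw i iz.
  have /andP[m1 m2] := cell_mid_itv pz iz'; have /andP[m3 m4] := cell_mid_itv pz iz.
  have dn : dense (-1 :: zt) (eps * h i) (knot z i.+1 - h i) (knot z i.+1 + h i).
    apply: (remesh_dense pz rem) => //.
    - by rewrite divr_gt0// mulr_gt0.
    - by lra.
    - by lra.
    - have E : eps / (2 * M) * Num.min (knot z i.+1 - knot z i) (knot z i.+2 - knot z i.+1) = eps * h i.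
        by rewrite /h /half_width; field; rewrite gt_eqF.
    have Eh : eps / (2 * M) * Num.min (knot z i.+1 - knot z i) (knot z i.+2 - knot z i.+1) = eps * h i.
      by rewrite /h /half_width; field; rewrite gt_eqF.
    rewrite -Eh; case: (leP (knot z i.+1 - knot z i) (knot z i.+2 - knot z i.+1)) => _; [left|right]; exact: lexx.
  have [||L hL] := hloc k _ _ _ hk hi dn (P i) (P i.+1) (B i) (sP i iz') (sP _ iz) (jump i iz).1 _ _ (hkap i).
  - by move=> x xi; apply: P0 => //; lra.
  - by move=> x xi; apply: P0 => //; lra.
  by exists L.
move=> /choice[LL hLL].
have kL i : (i.+1 < size z)%N -> knots_in (-1 :: zt) (knot z i.+1 - half_width M z i)
    (knot z i.+1 + half_width M z i) (LL i) by case/hLL.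
have pL i : (i.+1 < size z)%N -> tpoly m (LL i) = P i.+1 - P i by case/hLL.
have m0 : (0 < m)%N by rewrite /m addnS.
pose N := (size z).-1.
exists (fun y => (P 0%N).[y] + tspline m (gather LL N) y); split.
- rewrite /m addnS; split.
    apply: ppf_pspline => //; first by rewrite -addnS; apply: sP; exact: size_partition.
    move=> u /flatten_mapP[i]; rewrite mem_iota add0n ltn_pred_size => iz /kL.
    by case/(_ iz).
  exact: is_Ck_pspline.
- apply: q_monotone_pspline => // x x1.
  apply: (gather_ge0 (K := -1 :: zt) (M := M)) => // i iz.
  by exists (C * B i); exact: hLL.
move=> p j p0 jz; rewrite IsetE//.
have st_eq x : lower_end z j <= x <= upper_end z j -> _ :=
  fun hx => tspline_gather_Iset pz M1 m0 kL pL jz hx.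
have sz0 := size_partition pz.
have lu := Iset_lt pz jz.
have [cp0 mod0] : 0 < (C + M) / c0 * indic_norm p 1 (2 / l) /\
    (0 <= modulusJ m.+1 s `[lower_end z j, upper_end z j]%classic p)%E.
  split; last exact: modulusJ_ge0.
  by rewrite mulr_gt0 ?indic_norm_gt0 ?divr_gt0// addr_gt0.
have [j0|j1] := posnP j.
  rewrite j0 in st_eq lu mod0 *.
  apply: (@le_trans _ _ 0%E); last by rewrite mule_ge0// lee_fin ltW.
  apply: (@boundary_error _ _ _ _ (-1)) => // x; rewrite /= in_itv /= => xj x1.
  rewrite st_eq//=; rewrite /= /upper_end sz0 in xj.
  have := cell_mid_itv pz sz0 => mm; rewrite knot0 in mm.
  have xx : -1 < x by rewrite lt_neqAle eq_sym x1; case/andP: xj.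
  case: ifP => [iz|_].
    rewrite (tspline_left m0 (kL _ iz)).
      by rewrite addr0; apply: EP => //; rewrite knot0; lra.
    have [h1 _] := half_width_le pz iz M1; have := hw _ iz; rewrite /h; lra.
  by rewrite addr0; apply: EP => //; rewrite knot0; lra.
have [jn|jn] := eqVneq j (size z).
  apply: (@le_trans _ _ 0%E); last by rewrite mule_ge0// lee_fin ltW.
  apply: (@boundary_error _ _ _ _ 1) => // x; rewrite /= in_itv /= => xj x1.
  rewrite st_eq// jn prednK// ltnn addr0; apply: EP; first by rewrite prednK.
  have [x2 x3] := Iset_in_cells pz jz xj.
  rewrite prednK// knot_size//.
  rewrite jn in xj x2; rewrite /upper_end ltnn in xj.
  apply/andP; split; last by rewrite lt_neqAle x1; case/andP: xj.
  have := @cell_mid_itv _ z (size z).-1 pz; rewrite prednK// => /(_ (leqnn _)).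
  by move: xj; rewrite -[size z]prednK//= => /andP[]; lra.
have iz : (j.-1.+1 < size z)%N by rewrite prednK// ltn_neqAle jn.
move: st_eq lu mod0; rewrite /upper_end ltn_neqAle jn jz -(prednK j1) /=.
move: (j.-1) iz => i iz st_eq lu mod0 {j1 jn jz j}.
have [h1 h2] := half_width_le pz iz M1; rewrite -/(h i) in h1 h2.
have hi := hw0 i iz; have hi' := hw i iz; have iz' := ltnW iz.
have /andP[m1 m2] := cell_mid_itv pz iz'; have /andP[m3 m4] := cell_mid_itv pz iz.
have [_ _ _ bL] := hLL i iz.
have dB x : knot z i.+1 <= x <= knot z i.+1 + h i -> `|(P i.+1 - P i).[x]| <= M * B i.
  apply: (jump_bound hi _ (hkap i)); apply: size_comp_affine => //.
  by rewrite (leq_trans (size_polyD _ _))// size_polyN geq_max !sP.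
(* [C * B i] bounds the correction and [M * B i] bounds s - P_i: this is 0 left of the knot, the
   jump polynomial with its [M] coefficients right of it, and dominated by that polynomial at the
   knot. *)
apply: (@le_trans _ _ (indic_norm p ((C + M) * B i) (2 * h i))%:E).
  apply: (interior_error (e := knot z i.+1)) => //.
  - by rewrite mulr_ge0// addr_ge0// ltW.
  - move=> x; rewrite /= in_itv /= => xj [xl|xr]; rewrite st_eq// iz.
      rewrite (tspline_left m0 (kL _ iz)) ?(ltW xl)// addr0; apply: EP => //; lra.
    rewrite (tspline_right _ (kL _ iz)) ?(ltW xr)// pL// hornerD hornerN addrC subrK.
    by apply: EP => //; lra.
  - move=> x; rewrite /= in_itv /= => xj xe; rewrite st_eq// iz opprD addrA.
    rewrite (le_trans (ler_normB _ _))// mulrDl [leRHS]addrC lerD//; last exact: bL.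
    have MB0 : 0 <= M * B i by rewrite mulr_ge0// ltW.
    have [xl|xr|xe'] := ltgtP x (knot z i.+1).
    + by rewrite (EP i)// ?subrr ?normr0//; lra.
    + by rewrite (EP i.+1)// -?hornerN -?hornerD ?dB//; lra.
    + rewrite xe'; apply: (le_trans (jump i iz).2); apply: dB.
      by rewrite lexx lerDl ltW.
rewrite (indic_norm_ratio _ c00 l0 hi (B0 i)) ?EFinM; last by rewrite addr_ge0// ltW.
rewrite lee_wpmul2l ?lee_fin ?(ltW cp0)//.
apply: (hmod p (knot z i.+1) (h i) (cell_mid z i) (cell_mid z i.+1) s (P i) (P i.+1)) => //.
- exact: sP.
- exact: sP.
- by lra.
- by move=> t ti; apply: EP => //; lra.
- by move=> t ti; apply: EP => //; lra.
Qed.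

End Approximation.

Lemma is_remesh_le (R : realType) (d d' : R) (z zt : seq R) : d <= d' ->
  is_remesh d z zt -> is_remesh d' z zt.
Proof.
move=> dd [pzt h]; split=> // j jz i iz ne; apply: (le_trans (h j jz i iz ne)).
by rewrite lee_wpmul2r ?lee_fin// !le_min !abse_ge0.
Qed.

Theorem theorem1p2 (R : realType) (r : nat) (r_ge1 : (1 <= r)%N) :
  exists2 delta : R, 0 < delta &
  exists2 c : \bar R -> R, (forall p : \bar R, (0 < p)%E -> 0 < c p) &
  forall (q : nat), q = 1%N \/ q = 2%N ->
  forall (z : seq R), is_partition z ->
  forall (s : R -> R), ppf (q + r) z s -> q_monotone q s ->
  forall (zt : seq R), is_remesh delta z zt ->
  exists st : R -> R,
    [/\ spline (q + r) zt st,
        q_monotone q st &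
        forall (p : \bar R) (j : nat), (0 < p)%E -> (j <= size z)%N ->
          (Lpnorm p (Iset z j) (s \- st)%R <=
             (c p)%:E * modulusJ (q + r + 1) s (Iset z j) p)%E].
Proof.
case: r r_ge1 => // n _.
have [d1 d10 [c1 c10 H1]] := @spline_approx R 1 n (or_introl erefl).
have [d2 d20 [c2 c20 H2]] := @spline_approx R 2 n (or_intror erefl).
(* The constants must not depend on q: a smaller delta is harmless by [is_remesh_le], and a larger
   factor is harmless because the modulus is nonnegative. *)
exists (Num.min d1 d2); first by rewrite lt_min d10.
exists (fun p => c1 p + c2 p); first by move=> p p0; rewrite addr_gt0 ?c10 ?c20.
have mod_ge0 m z (f : R -> R) p j : is_partition z -> (j <= size z)%N ->
    (0 <= modulusJ m f (Iset z j) p)%E.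
  by move=> pz jz; rewrite IsetE//; apply: modulusJ_ge0; exact: Iset_lt.
move=> q [] -> z pz s ppfs qs zt rem; rewrite addn1.
  have [|st [sp qst est]] := H1 z pz s ppfs qs zt.
    by apply: is_remesh_le rem; rewrite ge_min lexx.
  exists st; split=> // p j p0 jz; apply: (le_trans (est p j p0 jz)).
  by rewrite lee_wpmul2r ?mod_ge0// lee_fin lerDl ltW// c20.
have [|st [sp qst est]] := H2 z pz s ppfs qs zt.
  by apply: is_remesh_le rem; rewrite ge_min lexx orbT.
exists st; split=> // p j p0 jz; apply: (le_trans (est p j p0 jz)).
by rewrite lee_wpmul2r ?mod_ge0// lee_fin lerDr ltW// c10.
Qed.
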